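(* The space $S_0$ of complete consistent $\mathcal{L}$-theories extending $T_{\mathrm{MSO(Fin)}}$, with its Stone topology and the binary operation $\oplus$ given by $T\oplus T'=\mathrm{Th}(M\oplus N)$ for any $M\models T$, $N\models T'$, is (isomorphic as a topological monoid to) the free profinite monoid on one generator.
   Context: Let $\mathcal{L}=\{\subseteq,\bot,\mathrm{At},\lhd\}$ be the first-order language with binary relation symbols $\subseteq,\lhd$, a constant $\bot$ and a unary relation symbol $\mathrm{At}$. For a linear order $(\alpha,<)$, $\mathrm{MSO}(\alpha)$ is the $\mathcal{L}$-structure with universe $\mathcal{P}(\alpha)$, $\subseteq$ inclusion, $\bot=\emptyset$, $\mathrm{At}$ the singletons, $A\lhd B$ iff some $a\in A$, $b\in B$ have $a<b$. Lowercase variables range over atoms; $X(x)$ abbreviates $x\subseteq X$. $T_{\mathrm{base}}$ states: $\subseteq$ is an atomic Boolean algebra order (one-element algebra allowed); $\lhd$ linearly orders the atoms; $\bot$ is least; $\mathrm{At}$ holds exactly of atoms; $\forall X\forall Y(X\lhd Y\leftrightarrow\exists x\exists y(X(x)\wedge Y(y)\wedge x\lhd y))$; and for every $\mathcal{L}$-formula $\eta(x;\bar Y)$, $\forall\bar Y\exists X\forall x(X(x)\leftrightarrow\eta(x;\bar Y))$. $T_{\mathrm{MSO(Fin)}}$ is $T_{\mathrm{base}}$ plus: the order on atoms is discrete with endpoints, and every $X\neq\bot$ contains a $\lhd$-least atom. For $M,N\models T_{\mathrm{base}}$, $M\oplus N$ is the $\mathcal{L}$-structure with universe $|M|\times|N|$,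 $\subseteq$ componentwise, $\bot$ and $\mathrm{At}$ the bottom and atoms of the resulting product Boolean algebra, and $(A,B)\lhd(C,D)$ iff ($A\neq\bot$ in $M$ and $D\neq\bot$ in $N$) or $M\models A\lhd C$ or $N\models B\lhd D$; $\mathrm{Th}(M\oplus N)$ depends only on the theories of $M$ and $N$. The Stone topology on $S_0$ has basic clopen sets $\langle\varphi\rangle=\{T\in S_0: T\models\varphi\}$ for $\mathcal{L}$-sentences $\varphi$. *)

(* Defs.v *)
From HB Require Import structures.
From mathcomp Require Import all_boot all_classical.
From mathcomp Require Import topology function_spaces.

Set Implicit Arguments.
Unset Strict Implicit.
Unset Printing Implicit Defensive.

Local Open Scope classical_set_scope.

(* Well-scoped de Bruijn syntax: the free variables of [p : formula n] are
   indexed by ['I_n], and [All] binds the variable of index 0. *)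
Inductive term (n : nat) : Type := Var of 'I_n | Bot.
Arguments Bot {n}.

Inductive formula (n : nat) : Type :=
| Eqf of term n & term n
| Subf of term n & term n
| Lhdf of term n & term n
| Atf of term n
| Fls
| Imp of formula n & formula n
| All of formula n.+1.
Arguments Fls {n}.

Definition sentence := formula 0.

Definition Not n (p : formula n) := Imp p Fls.
Definition And n (p q : formula n) := Not (Imp p (Not q)).
Definition Or n (p q : formula n) := Imp (Not p) q.
Definition Iff n (p q : formula n) := And (Imp p q) (Imp q p).
Definition Ex n (p : formula n.+1) := Not (All (Not p)).

Declare Scope formula_scope.
Delimit Scope formula_scope with F.
Bind Scope formula_scope with formula.
Notation "s =' t" := (Eqf s t) (at level 70, no associativity) : formula_scope.
Notation "s <=' t" := (Subf s t)
  (at level 70, no associativity) : formula_scope.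
Notation "s <|' t" := (Lhdf s t)
  (at level 70, no associativity) : formula_scope.
Notation "~' p" := (Not p) (at level 75, right associativity) : formula_scope.
Notation "p /\' q" := (And p q) (at level 80, right associativity)
  : formula_scope.
Notation "p \/' q" := (Or p q) (at level 85, right associativity)
  : formula_scope.
Notation "p ->' q" := (Imp p q) (at level 99, right associativity,
  q at level 200) : formula_scope.
Notation "p <->' q" := (Iff p q) (at level 95, no associativity)
  : formula_scope.

Record lstruct := LStruct {
  ldom :> Type;
  lsub : ldom -> ldom -> Prop;
  lbot : ldom;
  lat : ldom -> Prop;
  llhd : ldom -> ldom -> Prop }.
Arguments lbot {M} : rename.

Definition scons (A : Type) n (a : A) (e : 'I_n -> A) (i : 'I_n.+1) : A :=
  oapp e a (unlift ord0 i).

Arguments scons : simpl never.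

Definition teval (M : lstruct) n (e : 'I_n -> M) (t : term n) : M :=
  if t is Var i then e i else lbot.

Fixpoint sat (M : lstruct) n (p : formula n) : ('I_n -> M) -> Prop :=
  match p with
  | Eqf s t => fun e => teval e s = teval e t
  | Subf s t => fun e => lsub (teval e s) (teval e t)
  | Lhdf s t => fun e => llhd (teval e s) (teval e t)
  | Atf t => fun e => lat (teval e t)
  | Fls => fun _ => False
  | Imp p q => fun e => sat p e -> sat q e
  | All p => fun e => forall a, sat p (scons a e)
  end.

(* A sentence has no free variable, so the assignment is irrelevant. *)
Definition satisfies (M : lstruct) (p : sentence) : Prop :=
  sat p (fun _ : 'I_0 => lbot : M).
Notation "M |= p" := (satisfies M p) (at level 70, no associativity).

Definition models (M : lstruct) (T : set sentence) : Prop :=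
  forall p, T p -> M |= p.
Definition Th (M : lstruct) : set sentence := [set p | M |= p].
Definition entails (T : set sentence) (p : sentence) : Prop :=
  forall M : lstruct, models M T -> M |= p.
Definition consistent (T : set sentence) : Prop := exists M, models M T.
Definition complete (T : set sentence) : Prop :=
  forall p, T p \/ T (Not p).

Definition upren m n (f : 'I_m -> 'I_n) (i : 'I_m.+1) : 'I_n.+1 :=
  oapp (lift ord0 \o f) ord0 (unlift ord0 i).

Definition tren m n (f : 'I_m -> 'I_n) (t : term m) : term n :=
  if t is Var i then Var (f i) else Bot.

Fixpoint fren m n (f : 'I_m -> 'I_n) (p : formula m) : formula n :=
  match p with
  | Eqf s t => Eqf (tren f s) (tren f t)
  | Subf s t => Subf (tren f s) (tren f t)
  | Lhdf s t => Lhdf (tren f s) (tren f t)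
  | Atf t => Atf (tren f t)
  | Fls => Fls
  | Imp p q => Imp (fren f p) (fren f q)
  | All p => All (fren (upren f) p)
  end.

Fixpoint closure n : formula n -> sentence :=
  if n is m.+1 then fun p => closure (All p) else id.

Definition o1 {n} : 'I_n.+2 := lift ord0 ord0.
Definition o2 {n} : 'I_n.+3 := lift ord0 o1.
Definition o3 {n} : 'I_n.+4 := lift ord0 o2.
Definition o4 {n} : 'I_n.+4.+1 := lift ord0 o3.
Definition o5 {n} : 'I_n.+4.+2 := lift ord0 o4.
Definition o6 {n} : 'I_n.+4.+3 := lift ord0 o5.
Definition v0 {n} : term n.+1 := Var ord0.
Definition v1 {n} : term n.+2 := Var o1.
Definition v2 {n} : term n.+3 := Var o2.
Definition v3 {n} : term n.+4 := Var o3.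
Definition v4 {n} : term n.+4.+1 := Var o4.
Definition v5 {n} : term n.+4.+2 := Var o5.
Definition v6 {n} : term n.+4.+3 := Var o6.

Definition up n (t : term n) : term n.+1 := tren (lift ord0) t.

Section Macros.
Local Open Scope formula_scope.
Variable n : nat.
Implicit Types t x y z : term n.

Definition topF t : formula n := All (v0 <=' up t).
Definition meetF z x y : formula n :=
  z <=' x /\' z <=' y /\'
  All (v0 <=' up x ->' v0 <=' up y ->' v0 <=' up z).
Definition joinF z x y : formula n :=
  x <=' z /\' y <=' z /\'
  All (up x <=' v0 ->' up y <=' v0 ->' up z <=' v0).
Definition atomF t : formula n :=
  ~' (t =' Bot) /\' All (v0 <=' up t ->' v0 =' Bot \/' v0 =' up t).

(* Lowercase variables of the axioms range over atoms. *)
Definition AllAt (p : formula n.+1) : formula n := All (Atf v0 ->' p).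
Definition ExAt (p : formula n.+1) : formula n := Ex (Atf v0 /\' p).

End Macros.

Local Open Scope formula_scope.

Inductive T_base : set sentence :=
| base_refl : T_base (All (v0 <=' v0))
| base_antisym :
    T_base (All (All (v1 <=' v0 ->' v0 <=' v1 ->' v1 =' v0)))
| base_trans :
    T_base (All (All (All (v2 <=' v1 ->' v1 <=' v0 ->' v2 <=' v0))))
| base_bot : T_base (All (Bot <=' v0))
| base_top : T_base (Ex (topF v0))
| base_meet : T_base (All (All (Ex (meetF v0 v2 v1))))
| base_join : T_base (All (All (Ex (joinF v0 v2 v1))))
  (* [v6 /\ (v5 \/ v4) = (v6 /\ v5) \/ (v6 /\ v4)], where [v3 = v5 \/ v4],
     [v2 = v6 /\ v3], [v1 = v6 /\ v5] and [v0 = v6 /\ v4] *)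
| base_distr : T_base (All (All (All (All (All (All (All
    (joinF v3 v5 v4 ->' meetF v2 v6 v3 ->' meetF v1 v6 v5 ->'
     meetF v0 v6 v4 ->' joinF v2 v1 v0))))))))
| base_compl : T_base (All (Ex (meetF Bot v1 v0 /\'
    Ex (topF v0 /\' joinF v0 v2 v1))))
| base_atomic :
    T_base (All (~' (v0 =' Bot) ->' Ex (atomF v0 /\' v0 <=' v1)))
| base_At : T_base (All (Atf v0 <->' atomF v0))
| base_lhd_irrefl : T_base (AllAt (~' (v0 <|' v0)))
| base_lhd_trans :
    T_base (AllAt (AllAt (AllAt (v2 <|' v1 ->' v1 <|' v0 ->' v2 <|' v0))))
| base_lhd_total :
    T_base (AllAt (AllAt (v1 <|' v0 \/' v1 =' v0 \/' v0 <|' v1)))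
| base_lhd : T_base (All (All (v1 <|' v0 <->'
    ExAt (ExAt (v1 <=' v3 /\' v0 <=' v2 /\' v1 <|' v0)))))
(* comprehension: in [eta], variable 0 is [x] and the others are the
   parameters; [lift o1] makes room at index 1 for the new set [X] *)
| base_comprehension n (eta : formula n.+1) :
    T_base (closure (Ex (AllAt (v0 <=' v1 <->' fren (lift o1) eta)))).

(* The order of the atoms of the one-element algebra is empty; like every
   finite order, it counts as discrete with endpoints. *)
Inductive T_MSOFin : set sentence :=
| fin_base p : T_base p -> T_MSOFin p
| fin_first : T_MSOFin
    (ExAt (v0 =' v0) ->' ExAt (AllAt (v0 =' v1 \/' v1 <|' v0)))
| fin_last : T_MSOFin
    (ExAt (v0 =' v0) ->' ExAt (AllAt (v0 =' v1 \/' v0 <|' v1)))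
| fin_succ : T_MSOFin (AllAt (ExAt (v1 <|' v0) ->'
    ExAt (v1 <|' v0 /\' ~' ExAt (v2 <|' v0 /\' v0 <|' v1))))
| fin_pred : T_MSOFin (AllAt (ExAt (v0 <|' v1) ->'
    ExAt (v0 <|' v1 /\' ~' ExAt (v1 <|' v0 /\' v0 <|' v2))))
| fin_least : T_MSOFin (All (~' (v0 =' Bot) ->'
    ExAt (v0 <=' v1 /\' AllAt (v0 <=' v2 ->' v0 =' v1 \/' v1 <|' v0)))).

Local Close Scope formula_scope.

Definition is_atom (A : Type) (le : A -> A -> Prop) (bot a : A) : Prop :=
  a <> bot /\ forall b, le b a -> b = bot \/ b = a.

Definition osum (M N : lstruct) : lstruct :=
  let le (p q : M * N) := lsub p.1 q.1 /\ lsub p.2 q.2 in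
  let bot : M * N := (lbot, lbot) in
  {| ldom := (M * N)%type;
     lsub := le;
     lbot := bot;
     lat := is_atom le bot;
     llhd := fun p q =>
       (p.1 <> lbot /\ q.2 <> lbot) \/ llhd p.1 q.1 \/ llhd p.2 q.2 |}.

Section SatLemmas.
Context {M : lstruct} {n : nat}.
Implicit Types (p q : formula n) (e : 'I_n -> M) (t x y z : term n).

Lemma satNot p e : sat (Not p) e <-> ~ sat p e.
Proof. by []. Qed.

Lemma satImp p q e : sat (Imp p q) e <-> (sat p e -> sat q e).
Proof. by []. Qed.

Lemma satAnd p q e : sat (And p q) e <-> sat p e /\ sat q e.
Proof.
split=> /=; last by move=> [hp hq] h; exact: h hp hq.
by move=> h; split; apply: contrapT => hn; apply: h.
Qed.

Lemma satOr p q e : sat (Or p q) e <-> sat p e \/ sat q e.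
Proof.
split=> /= [h|[hp /(_ hp)|//] //].
by have [hp|hp] := pselect (sat p e); [left|right; exact: h].
Qed.

Lemma satIff p q e : sat (Iff p q) e <-> (sat p e <-> sat q e).
Proof. by rewrite /Iff satAnd /=; split=> -[]. Qed.

Lemma satAll (p : formula n.+1) e :
  sat (All p) e <-> forall a, sat p (scons a e).
Proof. by []. Qed.

Lemma satEx (p : formula n.+1) e :
  sat (Ex p) e <-> exists a, sat p (scons a e).
Proof.
split=> /= [h|[a ha] h]; last exact: h ha.
by apply: contrapT => hn; apply: h => a ha; apply: hn; exists a.
Qed.

End SatLemmas.

Section SatLemmas.
Context {M : lstruct} {n : nat}.
Implicit Types (e : 'I_n -> M) (t : term n).

Lemma satAllAt (p : formula n.+1) e :
  sat (AllAt p) e <-> forall a, lat a -> sat p (scons a e).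
Proof. by rewrite /= /scons unlift_none. Qed.

Lemma satExAt (p : formula n.+1) e :
  sat (ExAt p) e <-> exists a, lat a /\ sat p (scons a e).
Proof.
rewrite /ExAt satEx; split=> -[a].
  by rewrite satAnd /= /scons unlift_none => h; exists a.
by move=> h; exists a; rewrite satAnd /= /scons unlift_none.
Qed.

Lemma scons0 (a : M) e : scons a e ord0 = a.
Proof. by rewrite /scons unlift_none. Qed.

Lemma sconsS (a : M) e i : scons a e (lift ord0 i) = e i.
Proof. by rewrite /scons liftK. Qed.

Lemma teval_up (a : M) e t : teval (scons a e) (up t) = teval e t.
Proof. by case: t => //= i; rewrite sconsS. Qed.

End SatLemmas.

Lemma upren_scons (A : Type) m n (f : 'I_m -> 'I_n) (a : A) e :
  scons a e \o upren f = scons a (e \o f).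
Proof.
apply/funext => i /=; rewrite /upren /scons.
by case: (unlift ord0 i) => [j|] /=; rewrite ?liftK ?unlift_none.
Qed.

Lemma sat_fren (M : lstruct) m (p : formula m) n (f : 'I_m -> 'I_n)
    (e : 'I_n -> M) :
  sat (fren f p) e <-> sat p (e \o f).
Proof.
have ht k (t : term k) l (g : 'I_k -> 'I_l) (u : 'I_l -> M) :
    teval u (tren g t) = teval (u \o g) t by case: t.
elim: p n f e => {m} /= [k s t|k s t|k s t|k t|k|k p IHp q IHq|k p IHp] n f e;
  rewrite ?ht // ?IHp ?IHq //.
by split=> h a; have := h a; rewrite IHp upren_scons.
Qed.

Lemma sat_closure (M : lstruct) n (p : formula n) :
  M |= closure p <-> forall e : 'I_n -> M, sat p e.
Proof.
rewrite /satisfies; elim: n p => [|n IHn] p /=.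
  split=> [h e|]; last exact.
  by rewrite (_ : e = fun=> lbot) //; apply/funext => -[].
rewrite IHn /=; split=> h e; last by move=> a; apply: h.
rewrite (_ : e = scons (e ord0) (e \o lift ord0)); first exact: h.
by apply/funext => i; rewrite /scons; case: unliftP => [j ->|->].
Qed.

Definition is_top (A : Type) (le : A -> A -> Prop) t := forall a, le a t.
Definition is_meet (A : Type) (le : A -> A -> Prop) z x y :=
  [/\ le z x, le z y & forall w, le w x -> le w y -> le w z].
Definition is_join (A : Type) (le : A -> A -> Prop) z x y :=
  [/\ le x z, le y z & forall w, le x w -> le y w -> le z w].

Record base_struct (M : lstruct) : Prop := {
  bs_refl (a : M) : lsub a a;
  bs_antisym (a b : M) : lsub a b -> lsub b a -> a = b;
  bs_trans (a b c : M) : lsub a b -> lsub b c -> lsub a c;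
  bs_bot (a : M) : lsub lbot a;
  bs_top : exists t : M, is_top (@lsub M) t;
  bs_meet (a b : M) : exists c, is_meet (@lsub M) c a b;
  bs_join (a b : M) : exists c, is_join (@lsub M) c a b;
  bs_distr (a b c bc abc ab ac : M) : is_join (@lsub M) bc b c ->
    is_meet (@lsub M) abc a bc -> is_meet (@lsub M) ab a b ->
    is_meet (@lsub M) ac a c -> is_join (@lsub M) abc ab ac;
  bs_compl (a : M) : exists b, is_meet (@lsub M) lbot a b /\
    exists t, is_top (@lsub M) t /\ is_join (@lsub M) t a b;
  bs_atomic (a : M) : a <> lbot ->
    exists b, is_atom (@lsub M) lbot b /\ lsub b a;
  bs_At (a : M) : lat a <-> is_atom (@lsub M) lbot a;
  bs_lhd_irrefl (a : M) : lat a -> ~ llhd a a;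
  bs_lhd_trans (a b c : M) : lat a -> lat b -> lat c ->
    llhd a b -> llhd b c -> llhd a c;
  bs_lhd_total (a b : M) : lat a -> lat b ->
    [\/ llhd a b, a = b | llhd b a];
  bs_lhd (a b : M) : llhd a b <-> exists x y,
    [/\ lat x, lat y, lsub x a, lsub y b & llhd x y];
  bs_comprehension n (eta : formula n.+1) (e : 'I_n -> M) :
    exists X : M, forall x, lat x -> (lsub x X <-> sat eta (scons x e)) }.

Record fin_struct (M : lstruct) : Prop := {
  fs_base :> base_struct M;
  fs_first (a : M) : lat a ->
    exists x : M, lat x /\ forall y, lat y -> y = x \/ llhd x y;
  fs_last (a : M) : lat a ->
    exists x : M, lat x /\ forall y, lat y -> y = x \/ llhd y x;
  fs_succ (x y : M) : lat x -> lat y -> llhd x y -> exists s,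
    [/\ lat s, llhd x s & ~ exists z, [/\ lat z, llhd x z & llhd z s]];
  fs_pred (x y : M) : lat x -> lat y -> llhd y x -> exists s,
    [/\ lat s, llhd s x & ~ exists z, [/\ lat z, llhd s z & llhd z x]];
  fs_least (X : M) : X <> lbot -> exists x, [/\ lat x, lsub x X &
    forall y, lat y -> lsub y X -> y = x \/ llhd x y] }.

Section MacroLemmas.
Context {M : lstruct} {n : nat}.
Implicit Types (e : 'I_n -> M) (t x y z : term n).

Lemma sat_topF t e : sat (topF t) e <-> is_top (@lsub M) (teval e t).
Proof. by split=> h a; have := h a; rewrite /= teval_up scons0. Qed.

Lemma sat_meetF z x y e : sat (meetF z x y) e <->
  is_meet (@lsub M) (teval e z) (teval e x) (teval e y).
Proof.
rewrite /meetF !satAnd; split=> [[h1 [h2 h3]]|[h1 h2 h3]].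
  by split=> // w; have := h3 w; rewrite /= !teval_up scons0.
by split=> //; split=> // w; have := h3 w; rewrite /= !teval_up scons0.
Qed.

Lemma sat_joinF z x y e : sat (joinF z x y) e <->
  is_join (@lsub M) (teval e z) (teval e x) (teval e y).
Proof.
rewrite /joinF !satAnd; split=> [[h1 [h2 h3]]|[h1 h2 h3]].
  by split=> // w; have := h3 w; rewrite /= !teval_up scons0.
by split=> //; split=> // w; have := h3 w; rewrite /= !teval_up scons0.
Qed.

Lemma sat_atomF t e : sat (atomF t) e <->
  is_atom (@lsub M) lbot (teval e t).
Proof.
rewrite /atomF satAnd; split=> -[h1 h2]; split=> //.
  move=> a ha; have ha' : sat (v0 <=' up t)%F (scons a e).
    by rewrite /= teval_up scons0.
  by have /satAll/(_ a)/satImp/(_ ha')/satOr := h2; rewrite /= teval_up scons0.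
apply/satAll => a; apply/satImp; rewrite satOr /= teval_up scons0.
exact: h2.
Qed.

End MacroLemmas.

Section Variables.
Context {M : lstruct} {n : nat} {e : 'I_n -> M}.
Implicit Types a b c d f g h : M.

Let sc0 a : scons a e ord0 = a.
Proof. by rewrite ?sconsS scons0. Qed.
Let sc1 a b : scons b (scons a e) o1 = a.
Proof. by rewrite ?sconsS scons0. Qed.
Let sc2 a b c : scons c (scons b (scons a e)) o2 = a.
Proof. by rewrite ?sconsS scons0. Qed.
Let sc3 a b c d : scons d (scons c (scons b (scons a e))) o3 = a.
Proof. by rewrite ?sconsS scons0. Qed.
Let sc4 a b c d f : scons f (scons d (scons c (scons b (scons a e)))) o4 = a.
Proof. by rewrite ?sconsS scons0. Qed.
Let sc5 a b c d f g : scons g (scons f (scons d (scons c (scons b (scons a e))))) o5 = a.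
Proof. by rewrite ?sconsS scons0. Qed.
Let sc6 a b c d f g h : scons h (scons g (scons f (scons d (scons c (scons b (scons a e)))))) o6 = a.
Proof. by rewrite ?sconsS scons0. Qed.

Definition scons_o := (sc0, sc1, sc2, sc3, sc4, sc5, sc6).

Let tv0 a : teval (scons a e) v0 = a.
Proof. exact: sc0. Qed.
Let tv1 a b : teval (scons b (scons a e)) v1 = a.
Proof. exact: sc1. Qed.
Let tv2 a b c : teval (scons c (scons b (scons a e))) v2 = a.
Proof. exact: sc2. Qed.
Let tv3 a b c d : teval (scons d (scons c (scons b (scons a e)))) v3 = a.
Proof. exact: sc3. Qed.
Let tv4 a b c d f : teval (scons f (scons d (scons c (scons b (scons a e))))) v4 = a.
Proof. exact: sc4. Qed.
Let tv5 a b c d f g : teval (scons g (scons f (scons d (scons c (scons b (scons a e)))))) v5 = a.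
Proof. exact: sc5. Qed.
Let tv6 a b c d f g h : teval (scons h (scons g (scons f (scons d (scons c (scons b (scons a e))))))) v6 = a.
Proof. exact: sc6. Qed.

Definition teval_v := (scons_o, (tv0, tv1, tv2, tv3, tv4, tv5, tv6)).

End Variables.

Lemma T_baseP (M : lstruct) : models M T_base <-> base_struct M.
Proof.
split=> [h|h].
  have {}h p : T_base p -> sat p (fun=> lbot : M) by move/h.
  split.
  - by move=> a; have := h _ base_refl a; rewrite /= !teval_v.
  - by move=> a b; have := h _ base_antisym a b; rewrite /= !teval_v.
  - by move=> a b c; have := h _ base_trans a b c; rewrite /= !teval_v.
  - by move=> a; have := h _ base_bot a; rewrite /= !teval_v.
  - have /satEx[t] := h _ base_top.
    by move/sat_topF; rewrite teval_v; exists t.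
  - move=> a b; have /satAll/(_ a)/satAll/(_ b)/satEx[c] := h _ base_meet.
    by move/sat_meetF; rewrite !teval_v; exists c.
  - move=> a b; have /satAll/(_ a)/satAll/(_ b)/satEx[c] := h _ base_join.
    by move/sat_joinF; rewrite !teval_v; exists c.
  - move=> a b c bc abc ab ac hbc habc hab hac.
    have /satAll/(_ a)/satAll/(_ b)/satAll/(_ c)/satAll/(_ bc)/satAll/(_ abc)
      /satAll/(_ ab)/satAll/(_ ac) := h _ base_distr.
    set E := (X in sat _ X -> _) => hd.
    have h1 : sat (joinF v3 v5 v4) E by apply/sat_joinF; rewrite /E !teval_v.
    have h2 : sat (meetF v2 v6 v3) E by apply/sat_meetF; rewrite /E !teval_v.
    have h3 : sat (meetF v1 v6 v5) E by apply/sat_meetF; rewrite /E !teval_v.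
    have h4 : sat (meetF v0 v6 v4) E by apply/sat_meetF; rewrite /E !teval_v.
    move: hd => /satImp/(_ h1)/satImp/(_ h2)/satImp/(_ h3)/satImp/(_ h4).
    by move/sat_joinF; rewrite /E !teval_v.
  - move=> a; have /satAll/(_ a)/satEx[b /satAnd[/sat_meetF h1]] :=
      h _ base_compl.
    move=> /satEx[t /satAnd[/sat_topF h2 /sat_joinF h3]].
    by move: h1 h2 h3; rewrite !teval_v => h1 h2 h3; exists b; split=> //;
      exists t.
  - move=> a a0; have /satAll/(_ a)/satImp hc := h _ base_atomic.
    have a0' : sat (~' (v0 =' Bot))%F (scons a (fun _ : 'I_0 => lbot : M)).
      by rewrite /= !teval_v.
    have /satEx[b /satAnd[/sat_atomF]] := hc a0'.
    by rewrite /= !teval_v; exists b.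
  - move=> a; have /satAll/(_ a)/satIff := h _ base_At.
    by rewrite sat_atomF /= !teval_v.
  - move=> a; have /satAllAt := h _ base_lhd_irrefl.
    by move=> /(_ a); rewrite /= !teval_v.
  - move=> a b c ha hb hc; have /satAllAt/(_ a ha) := h _ base_lhd_trans.
    move=> /satAllAt/(_ b hb)/satAllAt/(_ c hc).
    by rewrite /= !teval_v.
  - move=> a b ha hb; have /satAllAt/(_ a ha) := h _ base_lhd_total.
    move=> /satAllAt/(_ b hb); rewrite !satOr /= !teval_v.
    by case=> [|[]] ?; [constructor 1|constructor 2|constructor 3].
  - move=> a b; have /satAll/(_ a)/satAll/(_ b)/satIff := h _ base_lhd.
    rewrite [X in X <-> _]/= !teval_v => ->; rewrite satExAt; split.
      move=> [x [hx /satExAt[y [hy]]]]; rewrite !satAnd /= !teval_v.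
      by move=> [? [? ?]]; exists x, y.
    move=> [x [y [hx hy h1 h2 h3]]]; exists x; split=> //; apply/satExAt.
    by exists y; split=> //; rewrite !satAnd /= !teval_v.
  move=> n eta e; have /sat_closure/(_ e) := h _ (base_comprehension eta).
  move=> /satEx[X hX]; exists X => x hx.
  move/satAllAt/(_ x hx)/satIff : hX; rewrite sat_fren /= !teval_v.
  rewrite (_ : scons x (scons X e) \o lift o1 = scons x e) //.
  apply/funext => i /=; case: (unliftP ord0 i) => [j ->|->].
    rewrite (_ : lift o1 _ = lift ord0 (lift ord0 j)) ?sconsS //.
    exact/val_inj.
  by rewrite (_ : lift o1 _ = ord0) ?scons0 //; exact/val_inj.
move=> _ []; rewrite /satisfies.
- by move=> a; rewrite /= !teval_v; exact: bs_refl.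
- by move=> a b; rewrite /= !teval_v; exact: bs_antisym.
- by move=> a b c; rewrite /= !teval_v; exact: bs_trans.
- by move=> a; rewrite /= !teval_v; exact: bs_bot.
- apply/satEx; have [t ht] := bs_top h; exists t.
  by apply/sat_topF; rewrite teval_v.
- apply/satAll=> a; apply/satAll=> b; apply/satEx; have [t ht] := bs_meet h a b; exists t.
  by apply/sat_meetF; rewrite !teval_v.
- apply/satAll=> a; apply/satAll=> b; apply/satEx; have [t ht] := bs_join h a b; exists t.
  by apply/sat_joinF; rewrite !teval_v.
- do 7!apply/satAll=> ?; apply/satImp=> /sat_joinF h1.
  apply/satImp=> /sat_meetF h2; apply/satImp=> /sat_meetF h3.
  apply/satImp=> /sat_meetF h4; apply/sat_joinF.
  by move: h1 h2 h3 h4; rewrite !teval_v; exact: bs_distr.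
- apply/satAll=> a; have [b [h1 [t [h2 h3]]]] := bs_compl h a.
  apply/satEx; exists b; apply/satAnd; split.
    by apply/sat_meetF; rewrite !teval_v.
  apply/satEx; exists t; apply/satAnd; split.
    by apply/sat_topF; rewrite !teval_v.
  by apply/sat_joinF; rewrite !teval_v.
- apply/satAll=> a; apply/satImp=> ha.
  have /(bs_atomic h)[b [h1 h2]] : a <> lbot by move: ha; rewrite /= teval_v.
  apply/satEx; exists b; apply/satAnd; split.
    by apply/sat_atomF; rewrite !teval_v.
  by rewrite /= !teval_v.
- apply/satAll=> a; apply/satIff; rewrite sat_atomF /= !teval_v.
  exact: bs_At.
- by apply/satAllAt => a ha; rewrite /= !teval_v; exact: bs_lhd_irrefl.
- apply/satAllAt => a ha; apply/satAllAt => b hb; apply/satAllAt => c hc.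
  by rewrite /= !teval_v; exact: bs_lhd_trans.
- apply/satAllAt => a ha; apply/satAllAt => b hb.
  rewrite !satOr /= !teval_v.
  by case: (bs_lhd_total h ha hb); [left|right; left|right; right].
- apply/satAll=> a; apply/satAll=> b; apply/satIff; rewrite satExAt.
  apply: (iff_trans (B := llhd a b)); first by rewrite /= !teval_v.
  rewrite (bs_lhd h); split.
    move=> [x [y [hx hy h1 h2 h3]]]; exists x; split=> //; apply/satExAt.
    by exists y; split=> //; rewrite !satAnd /= !teval_v.
  move=> [x [hx /satExAt[y [hy]]]]; rewrite !satAnd /= !teval_v.
  by move=> [? [? ?]]; exists x, y.
move=> n eta; apply/sat_closure => e; have [X hX] := bs_comprehension h eta e.
apply/satEx; exists X; apply/satAllAt => x hx; apply/satIff.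
rewrite sat_fren /= !teval_v.
rewrite (_ : scons x (scons X e) \o lift o1 = scons x e); first exact: hX.
apply/funext => i /=; case: (unliftP ord0 i) => [j ->|->].
  rewrite (_ : lift o1 _ = lift ord0 (lift ord0 j)) ?sconsS //.
  exact/val_inj.
by rewrite (_ : lift o1 _ = ord0) ?scons0 //; exact/val_inj.
Qed.

Lemma T_MSOFinP (M : lstruct) : models M T_MSOFin <-> fin_struct M.
Proof.
split=> [h|h].
  have hb : base_struct M by apply/T_baseP => p /fin_base/h.
  have {}h p : T_MSOFin p -> sat p (fun=> lbot : M) by move/h.
  have hat (a : M) : lat a -> sat (ExAt (v0 =' v0))%F (fun _ : 'I_0 => lbot : M).
    by move=> ha; apply/satExAt; exists a.
  split=> //.
  - move=> a /hat ha; have /satImp h1 := h _ fin_first.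
    have /satExAt[x [hx /satAllAt hy]] := h1 ha.
    by exists x; split=> // y /hy; rewrite satOr /= !teval_v.
  - move=> a /hat ha; have /satImp h1 := h _ fin_last.
    have /satExAt[x [hx /satAllAt hy]] := h1 ha.
    by exists x; split=> // y /hy; rewrite satOr /= !teval_v.
  - move=> x y hx hy hxy; have /satAllAt/(_ x hx)/satImp h1 := h _ fin_succ.
    have h2 : sat (ExAt (v1 <|' v0))%F (scons x (fun _ : 'I_0 => lbot : M)).
      by apply/satExAt; exists y; rewrite /= !teval_v.
    have /satExAt[s [hs /satAnd[hxs hz]]] := h1 h2.
    move: hxs; rewrite /= !teval_v => hxs; exists s; split=> // -[z [h3 h4 h5]].
    move/satNot: hz; apply; apply/satExAt; exists z; split=> //.
    by rewrite satAnd /= !teval_v.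
  - move=> x y hx hy hxy; have /satAllAt/(_ x hx)/satImp h1 := h _ fin_pred.
    have h2 : sat (ExAt (v0 <|' v1))%F (scons x (fun _ : 'I_0 => lbot : M)).
      by apply/satExAt; exists y; rewrite /= !teval_v.
    have /satExAt[s [hs /satAnd[hxs hz]]] := h1 h2.
    move: hxs; rewrite /= !teval_v => hxs; exists s; split=> // -[z [h3 h4 h5]].
    move/satNot: hz; apply; apply/satExAt; exists z; split=> //.
    by rewrite satAnd /= !teval_v.
  move=> X X0; have /satAll/(_ X)/satImp h1 := h _ fin_least.
  have X0' : sat (~' (v0 =' Bot))%F (scons X (fun _ : 'I_0 => lbot : M)).
    by rewrite /= !teval_v.
  have /satExAt[x [hx /satAnd[hxX /satAllAt hy]]] := h1 X0'.
  move: hxX; rewrite /= !teval_v => hxX; exists x; split=> // y /hy.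
  rewrite satImp satOr /= !teval_v => h2 h3; exact: h2.
move=> _ []; rewrite /satisfies.
- by move=> p; move: (fs_base h) => /T_baseP; exact.
- apply/satImp=> /satExAt[a [ha _]]; have [x [hx hy]] := fs_first h ha.
  apply/satExAt; exists x; split=> //; apply/satAllAt => y /hy.
  by rewrite satOr /= !teval_v.
- apply/satImp=> /satExAt[a [ha _]]; have [x [hx hy]] := fs_last h ha.
  apply/satExAt; exists x; split=> //; apply/satAllAt => y /hy.
  by rewrite satOr /= !teval_v.
- apply/satAllAt => x hx; apply/satImp => /satExAt[y [hy hxy]].
  have /(fs_succ h hx hy)[s [hs hxs hz]] : llhd x y.
    by move: hxy; rewrite /= !teval_v.
  apply/satExAt; exists s; split=> //; apply/satAnd; split.
    by rewrite /= !teval_v.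
  apply/satNot => /satExAt[z [h1 /satAnd[]]]; rewrite /= !teval_v => h2 h3.
  by apply: hz; exists z.
- apply/satAllAt => x hx; apply/satImp => /satExAt[y [hy hxy]].
  have /(fs_pred h hx hy)[s [hs hxs hz]] : llhd y x.
    by move: hxy; rewrite /= !teval_v.
  apply/satExAt; exists s; split=> //; apply/satAnd; split.
    by rewrite /= !teval_v.
  apply/satNot => /satExAt[z [h1 /satAnd[]]]; rewrite /= !teval_v => h2 h3.
  by apply: hz; exists z.
apply/satAll=> X; apply/satImp => hX.
have /(fs_least h)[x [hx hxX hy]] : X <> lbot.
  by move: hX; rewrite /= teval_v.
apply/satExAt; exists x; split=> //; apply/satAnd; split.
  by rewrite /= !teval_v.
apply/satAllAt => y y1; apply/satImp; rewrite satOr /= !teval_v.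
exact: hy.
Qed.

Record S0 := MkS0 {
  thy :> set sentence;
  thy_complete : complete thy;
  thy_consistent : consistent thy;
  thy_extends : T_MSOFin `<=` thy }.

Definition S0_clopen (p : sentence) : set S0 := [set T | entails T p].

HB.instance Definition _ := gen_eqMixin sentence.
HB.instance Definition _ := gen_choiceMixin sentence.
HB.instance Definition _ := isPointed.Build sentence Fls.

HB.instance Definition _ := gen_eqMixin S0.
HB.instance Definition _ := gen_choiceMixin S0.

Lemma S0_cover : \bigcup_(p in setT) S0_clopen p = setT.
Proof.
by apply/seteqP; split=> // T _; exists (Not Fls) => // M _; exact.
Qed.

Lemma S0_join (p q : sentence) (T : S0) : setT p -> setT q ->
  S0_clopen p T -> S0_clopen q T ->
  exists r, [/\ setT r, S0_clopen r T &
    S0_clopen r `<=` S0_clopen p `&` S0_clopen q].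
Proof.
move=> _ _ hp hq; exists (And p q); split=> //.
  by move=> M hM; apply/satAnd; split; [exact: hp|exact: hq].
by move=> U hU; split=> M /hU/satAnd[].
Qed.

HB.instance Definition _ := isBaseTopological.Build S0 S0_cover S0_join.

Definition is_oplus (op : S0 -> S0 -> S0) : Prop :=
  forall (T U : S0) (M N : lstruct), models M T -> models N U ->
    thy (op T U) = Th (osum M N).

HB.structure Definition PreTopologicalMonoid :=
  {M of Monoid M & Topological M}.

HB.mixin Record PreTopologicalMonoid_isTopologicalMonoid M
    of PreTopologicalMonoid M := {
  mul_continuous : continuous (fun x : M * M => (x.1 * x.2)%g : M) }.

#[short(type="topologicalMonoidType")]
HB.structure Definition TopologicalMonoid :=
  {M of PreTopologicalMonoid M & PreTopologicalMonoid_isTopologicalMonoid M}.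

Definition topmonoid_isomorphic (P Q : topologicalMonoidType) : Prop :=
  exists (f : P -> Q) (g : Q -> P),
    [/\ cancel f g, cancel g f, monoid_morphism f,
        continuous f & continuous g].

#[short(type="finMonoidType")]
HB.structure Definition FinMonoid := {M of Monoid M & Finite M}.

Record inverse_system := InverseSystem {
  idx : Type;
  idx_le : idx -> idx -> Prop;
  idx_refl : forall i, idx_le i i;
  idx_trans : forall i j k, idx_le i j -> idx_le j k -> idx_le i k;
  idx_inhabited : inhabited idx;
  idx_directed : forall i j, exists k, idx_le i k /\ idx_le j k;
  stage : idx -> finMonoidType;
  transition : forall i j, idx_le i j -> stage j -> stage i;
  transition_morphism : forall i j (h : idx_le i j),
    monoid_morphism (transition h);
  transition_id : forall i (h : idx_le i i), transition h =1 id;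
  transition_comp : forall i j k (hij : idx_le i j) (hjk : idx_le j k)
    (hik : idx_le i k), transition hij \o transition hjk =1 transition hik }.

Section InverseLimit.
Variable D : inverse_system.

Definition threads :
    set (prod_topology (fun i : idx D => discrete_topology (stage i))) :=
  [set x | forall i j (h : idx_le i j), transition h (x j) = x i].

Definition invlim : Type := set_type threads.
HB.instance Definition _ := Topological.on invlim.

Definition coord (x : invlim) (i : idx D) : stage i := set_val x i.

Lemma coordP (x : invlim) i j (h : idx_le i j) :
  transition h (coord x j) = coord x i.
Proof. exact: (set_valP x). Qed.

Definition mk_invlim (x : forall i, stage i)
    (hx : forall i j (h : idx_le i j), transition h (x j) = x i) : invlim :=
  SigSub (mem_set (hx : threads x)).

Lemma coord_mk x hx i : coord (@mk_invlim x hx) i = x i.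
Proof. by []. Qed.

Lemma coord_inj (x y : invlim) : (forall i, coord x i = coord y i) -> x = y.
Proof. by move=> h; apply: val_inj; apply: functional_extensionality_dep. Qed.

Definition invlim_one : invlim :=
  mk_invlim (fun i j h => (transition_morphism h).1).

Definition invlim_mul (x y : invlim) : invlim.
Proof.
apply: (@mk_invlim (fun i => (coord x i * coord y i)%g)) => i j h.
by rewrite (transition_morphism h).2 !coordP.
Defined.

Lemma invlim_mulA : associative invlim_mul.
Proof. by move=> x y z; apply: coord_inj => i; exact: mulgA. Qed.

Lemma invlim_mul1 : left_id invlim_one invlim_mul.
Proof. by move=> x; apply: coord_inj => i; exact: mul1g. Qed.

Lemma invlim_1mul : right_id invlim_one invlim_mul.
Proof. by move=> x; apply: coord_inj => i; exact: mulg1. Qed.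

HB.instance Definition _ :=
  isMonoid.Build invlim invlim_mulA invlim_mul1 invlim_1mul.

Lemma coord_continuous (i : idx D) :
  continuous ((fun x => coord x i) : invlim -> discrete_topology (stage i)).
Proof.
move=> x; apply: (@continuous_comp _ _ _ (set_val : invlim -> _)
    (fun y : prod_topology (fun i => discrete_topology (stage i)) => y i)).
  exact: initial_continuous.
exact: (@proj_continuous {classic idx D}
  (fun i => discrete_topology (stage i)) i).
Qed.

Lemma invlim_mul_continuous :
  continuous (fun x : invlim * invlim => (x.1 * x.2)%g : invlim).
Proof.
apply: continuous_comp_initial => x.
apply/cvg_sup.
move=> i; move: x; apply/(@continuousP _ (initial_topology (@^~ i))).
move=> A [B _ <-]; rewrite openE => x Bx.
have hx (y : invlim) : nbhs y [set z | coord z i = coord y i].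
  exact: (@coord_continuous i y _
    (discrete_set1 (coord y i : discrete_topology _))).
exists ([set z | coord z i = coord x.1 i], [set z | coord z i = coord x.2 i]).
  by split; exact: hx.
move=> [y z] [/= hy hz]; move: Bx; rewrite /preimage /=.
rewrite -[set_val (x.1 * x.2)%g i]/(coord x.1 i * coord x.2 i)%g -hy -hz.
exact.
Qed.

HB.instance Definition _ :=
  PreTopologicalMonoid_isTopologicalMonoid.Build invlim invlim_mul_continuous.

End InverseLimit.

Definition profinite (P : topologicalMonoidType) : Prop :=
  exists D : inverse_system, topmonoid_isomorphic P (invlim D).

Definition free_profinite_monoid1 (F : topologicalMonoidType) (g : F) : Prop :=
  profinite F /\
  forall P : topologicalMonoidType, profinite P -> forall p : P,
    exists! h : F -> P, [/\ continuous h, monoid_morphism h & h g = p].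

Section S0Monoid.
Variables (op : S0 -> S0 -> S0) (e : S0).
Hypotheses (opA : associative op) (op1 : left_id e op) (op1r : right_id e op).
Hypothesis op_continuous : continuous (fun x : S0 * S0 => op x.1 x.2).

Definition S0_monoid : monoidType :=
  HB.pack S0 (isMonoid.Build S0 opA op1 op1r).
Definition S0_topmonoid : topologicalMonoidType :=
  HB.pack S0 (isMonoid.Build S0 opA op1 op1r)
    (PreTopologicalMonoid_isTopologicalMonoid.Build S0_monoid op_continuous).
End S0Monoid.

(* Main.v *)
(* Everything is read off the k-types of structures, the finitely many
   equivalence classes of indistinguishability by formulas of quantifier
   depth k.  The k-type of M (+) N depends only on those of M and N.  Every
   model of T_MSO(Fin) has the k-type of some finite MSO(n): the initial
   segments [0, x] without this property form a definable set of endpoints x,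
   and its least element cannot exist, because [0, x + 1] is the sum of [0, x]
   and a point.  Hence the k-types of models form a finite quotient monoid of
   the natural numbers, and by compactness (an ultraproduct of finite
   structures) S_0 is the inverse limit of these quotients.  For the universal
   property it remains to see that every morphism from the natural numbers to
   a finite monoid factors through k-types for some k: its fibres are finite
   unions of points and arithmetic progressions, and "n lies in r + b nat" is
   expressed by a sentence. *)
Require Import Defs.
From HB Require Import structures.
From mathcomp Require Import all_boot all_classical.
From mathcomp Require Import topology function_spaces.

Set Implicit Arguments.
Unset Strict Implicit.
Unset Printing Implicit Defensive.

Local Open Scope classical_set_scope.

(** * Types of finite quantifier depth *)

(** [None] codes the constant. A finite type of codes keeps the number of types finite. *)
Definition atomic_index n : finType :=
  (bool * bool * option 'I_n * option 'I_n)%type.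

Definition index_term n (o : option 'I_n) : term n :=
  if o is Some i then Var i else Bot.

Definition atomic_formula n (x : atomic_index n) : formula n :=
  let: (b, c, s, t) := x in
  match b, c with
  | true, true => Eqf (index_term s) (index_term t)
  | true, false => Subf (index_term s) (index_term t)
  | false, true => Lhdf (index_term s) (index_term t)
  | false, false => Atf (index_term s)
  end.

(** Hintikka types as hereditarily finite sets: at depth k + 1, the set of types of the one-point
    extensions. That there are finitely many is built in. *)
Fixpoint tp (k n : nat) : finType :=
  if k is k'.+1 then {set tp k' n.+1} else {set atomic_index n}.

Fixpoint typ (M : lstruct) (k : nat) : forall n, ('I_n -> M) -> tp k n :=
  match k return forall n, ('I_n -> M) -> tp k n with
  | 0 => fun n e => [set x | `[< sat (atomic_formula x) e >]]%SET
  | k'.+1 => fun n e => [set t | `[< exists a, typ k' (scons a e) = t >]]%SET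
  end.
Arguments typ : clear implicits.
Arguments typ {M} k {n} e.

Fixpoint depth n (p : formula n) : nat :=
  match p with
  | Imp p q => maxn (depth p) (depth q)
  | All p => (depth p).+1
  | _ => 0
  end.

Section Types.
Context {M N : lstruct}.

Lemma typ0P n (e : 'I_n -> M) (e' : 'I_n -> N) :
  typ 0 e = typ 0 e' <->
  forall x, sat (atomic_formula x) e <-> sat (atomic_formula x) e'.
Proof.
split=> [/setP h x|h].
  by have := h x; rewrite !inE => hx; split=> /asboolP; [rewrite hx|rewrite -hx] => /asboolP.
by apply/setP => x; rewrite !inE; apply/asbool_equiv_eq.
Qed.

(** The back-and-forth condition of Ehrenfeucht-Fraisse games. *)
Lemma typSP k n (e : 'I_n -> M) (e' : 'I_n -> N) :
  typ k.+1 e = typ k.+1 e' <->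
  (forall a, exists b, typ k (scons a e) = typ k (scons b e')) /\
  (forall b, exists a, typ k (scons a e) = typ k (scons b e')).
Proof.
split=> [/setP h|[h1 h2]].
  split=> [a|b].
    have := h (typ k (scons a e)); rewrite !inE => ha.
    have /asboolP : `[< exists c, typ k (scons c e) = typ k (scons a e) >].
      by apply/asboolP; exists a.
    by move/asboolP; rewrite ha => /asboolP[b hb]; exists b.
  have := h (typ k (scons b e')); rewrite !inE => hb.
  by apply/asboolP; rewrite hb; apply/asboolP; exists b.
apply/setP => t; rewrite !inE; apply/asbool_equiv_eq; split=> -[a <-].
  by have [b hb] := h1 a; exists b.
by have [b hb] := h2 a; exists b.
Qed.

Lemma typ_pred k n (e : 'I_n -> M) (e' : 'I_n -> N) :
  typ k.+1 e = typ k.+1 e' -> typ k e = typ k e'.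
Proof.
elim: k n e e' => [|k IHk] n e e' /typSP[h1 h2].
  (* The new point is arbitrary: only atomic formulas whose indices avoid it are kept. *)
  have [b /typ0P hb] := h1 lbot; apply/typ0P => -[[[c d] s] t].
  pose up_ix := omap (lift (@ord0 n)).
  have hix (K : lstruct) (f : 'I_n -> K) a o :
      teval (scons a f) (index_term (up_ix o)) = teval f (index_term o).
    by case: o => //= i; rewrite sconsS.
  by have := hb (c, d, up_ix s, up_ix t); case: c; case: d; rewrite /= !hix.
apply/typSP; split=> [a|b].
  by have [b /IHk hb] := h1 a; exists b.
by have [a /IHk ha] := h2 b; exists a.
Qed.

Lemma typ_leq j k n (e : 'I_n -> M) (e' : 'I_n -> N) :
  j <= k -> typ k e = typ k e' -> typ j e = typ j e'.
Proof.
move=> /subnK <-; elim: (k - j) => // i IHi; rewrite addSn => /typ_pred.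
exact: IHi.
Qed.

Lemma typ_atomic k n (x : atomic_index n) (e : 'I_n -> M) (e' : 'I_n -> N) :
  typ k e = typ k e' ->
  (sat (atomic_formula x) e <-> sat (atomic_formula x) e').
Proof. by move/(typ_leq (leq0n k))/typ0P. Qed.

End Types.

(** At a quantifier, back-and-forth turns each value on one side into one of the same type on the
    other. *)
Lemma typ_sat n (p : formula n) (M N : lstruct) k (e : 'I_n -> M) (e' : 'I_n -> N) :
  depth p <= k -> typ k e = typ k e' -> (sat p e <-> sat p e').
Proof.
pose o n (t : term n) := if t is Var i then Some i else None.
have oK m (t : term m) : t = index_term (o m t) by case: t.
elim: p k e e' => {n} [n s t|n s t|n s t|n s|n|n p IHp q IHq|n p IHp] k e e'.
- by move=> _ /(typ_atomic (true, true, o n s, o n t)); rewrite /= -!oK.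
- by move=> _ /(typ_atomic (true, false, o n s, o n t)); rewrite /= -!oK.
- by move=> _ /(typ_atomic (false, true, o n s, o n t)); rewrite /= -!oK.
- by move=> _ /(typ_atomic (false, false, o n s, None)); rewrite /= -!oK.
- by [].
- rewrite /= geq_max => /andP[hp hq] he.
  by have := IHp _ _ _ hp he; have := IHq _ _ _ hq he; rewrite /=; tauto.
case: k => // k hp /typSP[h1 h2]; split=> /= h a.
  by have [b /(IHp _ _ _ hp) hb] := h2 a; apply/hb.
by have [b /(IHp _ _ _ hp) hb] := h1 a; apply/hb.
Qed.

(** * Definability of types *)

Definition definable n (Q : forall M : lstruct, ('I_n -> M) -> Prop) :=
  exists p : formula n, forall (M : lstruct) (e : 'I_n -> M), sat p e <-> Q M e.

Lemma definable_all (U : finType) n (Q : U -> forall M : lstruct, ('I_n -> M) -> Prop) :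
  (forall u, definable (Q u)) -> definable (fun M e => forall u, Q u M e).
Proof.
move=> h; have [f hf] := choice h.
exists (foldr (fun u p => And (f u) p) (Not Fls) (enum U)) => M e.
suff hs s : sat (foldr (fun u p => And (f u) p) (Not Fls) s) e <->
    forall u, u \in s -> Q u M e.
  by rewrite hs; split=> H u; [apply: H; rewrite mem_enum | move=> _; exact: H].
elim: s => [|u s IHs]; first by split=> // _; rewrite /=.
rewrite [foldr _ _ _]/= satAnd IHs hf; split=> [[h1 h2] v|H].
  by rewrite inE => /predU1P[->|/h2].
by split=> [|v vs]; apply: H; rewrite inE ?eqxx ?vs ?orbT.
Qed.

Lemma definableN n (Q : forall M : lstruct, ('I_n -> M) -> Prop) :
  definable Q -> definable (fun M e => ~ Q M e).
Proof. by move=> [p hp]; exists (Not p) => M e; rewrite satNot hp. Qed.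

Lemma definable_ext n (Q Q' : forall M : lstruct, ('I_n -> M) -> Prop) :
  (forall M e, Q M e <-> Q' M e) -> definable Q -> definable Q'.
Proof. by move=> h [p hp]; exists p => M e; rewrite hp. Qed.

(** Since [U] is finite, [A (F M e)] says that [F M e] differs from each of finitely many sets, and
    equality with a set is a finite conjunction about membership. *)
Lemma definable_set (U : finType) n (F : forall M : lstruct, ('I_n -> M) -> {set U})
    (A : {set U} -> Prop) :
  (forall u, definable (fun M e => u \in F M e)) ->
  definable (fun M e => A (F M e)).
Proof.
move=> h.
have hs (s : {set U}) : definable (fun M e => ~ A s -> F M e <> s).
  have [As|nAs] := pselect (A s).
    by exists (Not Fls) => M e; split=> [_ /(_ As)|_ H] .
  apply: (@definable_ext _ (fun M e => ~ forall u, (u \in F M e) = (u \in s))).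
    move=> M e; split=> [H _ Fs|H Fs]; first by apply: H; rewrite Fs.
    by apply: H => //; apply/setP.
  apply/definableN/definable_all => u; have [us|us] := boolP (u \in s).
    exact: h.
  apply: definable_ext (definableN (h u)) => M e.
  by split=> [/negP/negbTE|->].
apply: definable_ext (definable_all hs) => M e; split=> [H|H s nAs Fs].
  by apply: contrapT => /H.
by apply: nAs; rewrite -Fs.
Qed.

(** Hintikka formulas. One formula serves all structures, which lets comprehension and ultraproducts
    speak about types. *)
Lemma definable_typ k n (A : tp k n -> Prop) :
  definable (fun M e => A (typ k e)).
Proof.
elim: k n A => [|k IHk] n A; apply: definable_set => u.
  by exists (atomic_formula u) => M e; rewrite inE; split=> /asboolP.
have [p hp] := IHk _ (eq^~ u).
exists (Ex p) => M e; rewrite satEx inE; split.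
  by move=> [a /hp ha]; apply/asboolP; exists a.
by move=> /asboolP[a ha]; exists a; apply/hp.
Qed.

(* The part of [base_struct] that makes [lat] and [lbot] definable from the
   order, so that an order isomorphism preserves them. *)
Record atomic_order (M : lstruct) : Prop := {
  ao_refl (a : M) : lsub a a;
  ao_antisym (a b : M) : lsub a b -> lsub b a -> a = b;
  ao_bot (a : M) : lsub lbot a;
  ao_At (a : M) : lat a <-> is_atom (@lsub M) lbot a }.

Lemma base_atomic_order M : base_struct M -> atomic_order M.
Proof.
move=> h; split; [exact: bs_refl|exact: bs_antisym|exact: bs_bot|exact: bs_At].
Qed.

Section Isomorphism.
Context {M N : lstruct} (hM : atomic_order M) (hN : atomic_order N).
Variable R : M -> N -> Prop.
Hypotheses (Rtotal : forall a, exists b, R a b)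
  (Rsurj : forall b, exists a, R a b)
  (Rsub : forall a b a' b', R a b -> R a' b' -> (lsub a a' <-> lsub b b'))
  (Rlhd : forall a b a' b', R a b -> R a' b' -> (llhd a a' <-> llhd b b')).

Let Req a b a' b' : R a b -> R a' b' -> (a = a' <-> b = b').
Proof.
move=> h h'; split=> E.
  by apply: (ao_antisym hN); [apply/(Rsub h h')|apply/(Rsub h' h)];
    rewrite E; exact: ao_refl.
by apply: (ao_antisym hM); [apply/(Rsub h h')|apply/(Rsub h' h)];
  rewrite E; exact: ao_refl.
Qed.

Let Rbot : R lbot lbot.
Proof.
have [b hb] := Rtotal lbot.
suff -> : lbot = b by [].
apply: (ao_antisym hN); first exact: ao_bot.
by have [a ha] := Rsurj lbot; apply/(Rsub hb ha); exact: ao_bot.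
Qed.

Let Rlat a b : R a b -> (lat a <-> lat b).
Proof.
move=> h; rewrite (ao_At hM) (ao_At hN); split=> -[h1 h2]; split.
- by move/(Req h Rbot).
- move=> c; have [d hd] := Rsurj c; move/(Rsub hd h)/h2.
  by rewrite -(Req hd Rbot) -(Req hd h).
- by move/(Req h Rbot).
move=> c; have [d hd] := Rtotal c; move/(Rsub hd h)/h2.
by rewrite (Req hd Rbot) (Req hd h).
Qed.

(** An isomorphism given as a relation, so that no values have to be chosen. Antisymmetry makes it
    one-to-one and compatible with bottom and atoms; totality on both sides gives back-and-forth. *)
Lemma iso_typ k n (e : 'I_n -> M) (e' : 'I_n -> N) :
  (forall i, R (e i) (e' i)) -> typ k e = typ k e'.
Proof.
have hscons m a b (f : 'I_m -> M) (f' : 'I_m -> N) : R a b ->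
    (forall i, R (f i) (f' i)) -> forall i, R (scons a f i) (scons b f' i).
  by move=> hab hf i; case: (unliftP ord0 i) => [j|] ->; rewrite ?sconsS ?scons0.
elim: k n e e' => [|k IHk] n e e' he.
  apply/typ0P => -[[[c d] s] t].
  have ht o : R (teval e (index_term o)) (teval e' (index_term o)) by case: o.
  case: c; case: d => /=; [exact: Req|exact: Rsub|exact: Rlhd|exact: Rlat].
apply/typSP; split=> [a|b].
  by have [b hb] := Rtotal a; exists b; apply/IHk/hscons.
by have [a ha] := Rsurj b; exists a; apply/IHk/hscons.
Qed.

End Isomorphism.

(** * Types of sums *)

Definition no_var (M : lstruct) : 'I_0 -> M := fun=> lbot.
Arguments no_var : clear implicits.

Definition styp (k : nat) (M : lstruct) : tp k 0 := typ k (no_var M).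

Lemma osum_atom (M N : lstruct) (a : M) (b : N) :
  atomic_order M -> atomic_order N ->
  @lat (osum M N) (a, b) <-> (lat a /\ b = lbot) \/ (a = lbot /\ lat b).
Proof.
move=> hM hN; rewrite (ao_At hM) (ao_At hN) /= /is_atom /=; split.
  move=> [h1 h2].
  have h3 (c : M) : lsub c a -> c = lbot \/ c = a /\ b = lbot.
    move=> hc; have /= := h2 (c, lbot); case; first by split=> //; exact: ao_bot.
      by case=> ->; left.
    by case=> -> ->; right.
  have h4 (c : N) : lsub c b -> c = lbot \/ c = b /\ a = lbot.
    move=> hc; have /= := h2 (lbot, c); case; first by split=> //; exact: ao_bot.
      by case=> ->; left.
    by case=> -> ->; right.
  have [a0|a0] := pselect (a = lbot).
    right; split=> //; split; first by move=> b0; apply: h1; rewrite a0 b0.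
    by move=> c /h4[|[]]; auto.
  left; have [//|[_ b0]] := h3 a (ao_refl hM a); split=> //; split=> //.
  by move=> c /h3[|[]]; auto.
move=> [[[h1 h2] ->]|[-> [h1 h2]]]; split=> [[//]|[c d] /= [hc hd]].
  have -> : d = lbot by apply: (ao_antisym hN) => //; exact: ao_bot.
  by case: (h2 c hc) => ->; auto.
have -> : c = lbot by apply: (ao_antisym hM) => //; exact: ao_bot.
by case: (h2 d hd) => ->; auto.
Qed.

Lemma osum_atomic_order (M N : lstruct) :
  atomic_order M -> atomic_order N -> atomic_order (osum M N).
Proof.
move=> hM hN; split=> //=.
- by move=> a; split; exact: ao_refl.
- move=> [a b] [c d] /= [h1 h2] [h3 h4].
  by congr pair; [exact: (ao_antisym hM)|exact: (ao_antisym hN)].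
- by move=> a; split; exact: ao_bot.
Qed.

Section Composition.
Context {M N M' N' : lstruct}.
Hypotheses (hM : atomic_order M) (hN : atomic_order N).
Hypotheses (hM' : atomic_order M') (hN' : atomic_order N').

(** Composition in the style of Feferman and Vaught: a move in the sum is a pair of moves, each
    answered in its own summand. *)
Lemma osum_typ k n (a : 'I_n -> M) (b : 'I_n -> N) (a' : 'I_n -> M')
    (b' : 'I_n -> N') :
  typ k a = typ k a' -> typ k b = typ k b' ->
  typ k (fun i => (a i, b i) : osum M N) =
  typ k (fun i => (a' i, b' i) : osum M' N').
Proof.
have hscons (K L : lstruct) m (u : 'I_m -> K) (v : 'I_m -> L) (x : osum K L) :
    scons x (fun i => (u i, v i) : osum K L) =
    (fun i => (scons x.1 u i, scons x.2 v i)).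
  by case: x => x y; apply/funext => i; rewrite /scons; case: (unlift ord0 i).
elim: k n a b a' b' => [|k IHk] n a b a' b' ha hb.
  apply/typ0P => -[[[c d] s] t].
  have hteval (K L : lstruct) (u : 'I_n -> K) (v : 'I_n -> L) o :
      teval (fun i => (u i, v i) : osum K L) (index_term o) =
      (teval u (index_term o), teval v (index_term o)) by case: o.
  have hat x := typ_atomic x ha; have hbt x := typ_atomic x hb.
  case: c; case: d; rewrite [sat _ _]/= [X in _ <-> X]/= !hteval.
  - have := hat (true, true, s, t); have := hbt (true, true, s, t) => /= h1 h2.
    by split=> -[]; [move=> /h2 -> /h1 ->|move=> /h2 -> /h1 ->].
  - by have := hat (true, false, s, t); have := hbt (true, false, s, t); rewrite /=; tauto.
  - have := hat (false, true, s, t); have := hbt (false, true, s, t).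
    (* The clause on nonempty sides compares with the constant, hence is decided by the types. *)
    by have := hat (true, true, s, None); have := hbt (true, true, t, None); rewrite /=; tauto.
  - rewrite -[is_atom _ _ _]/(@lat (osum M N) _) -[X in _ <-> X]/(@lat (osum M' N') _).
    rewrite !osum_atom //.
    have := hat (false, false, s, None); have := hbt (false, false, s, None).
    by have := hat (true, true, s, None); have := hbt (true, true, s, None); rewrite /=; tauto.
case/typSP: ha => ha1 ha2; case/typSP: hb => hb1 hb2.
apply/typSP; split=> -[x y].
  have [x' hx] := ha1 x; have [y' hy] := hb1 y; exists (x', y').
  by rewrite !hscons; exact: IHk.
have [x' hx] := ha2 x; have [y' hy] := hb2 y; exists (x', y').
by rewrite !hscons; exact: IHk.
Qed.

Lemma osum_styp k : styp k M = styp k M' -> styp k N = styp k N' ->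
  styp k (osum M N) = styp k (osum M' N').
Proof. exact: osum_typ. Qed.

End Composition.

Lemma styp_satisfies k (M N : lstruct) (p : sentence) : depth p <= k ->
  styp k M = styp k N -> (M |= p <-> N |= p).
Proof. exact: typ_sat. Qed.

(** * Restrictions and the finite structures *)

Section BaseStruct.
Context {M : lstruct} (hM : base_struct M).

Lemma bs_atom_in_bot (x : M) : lat x -> ~ lsub x lbot.
Proof.
move=> /(bs_At hM)[x0 _] h; apply: x0.
exact: (bs_antisym hM h (bs_bot hM x)).
Qed.

Lemma bs_atom_sub (x y : M) : lat x -> lat y -> lsub x y -> x = y.
Proof.
move=> hx /(bs_At hM)[_ hy] /hy[x0|//].
by case: (@bs_atom_in_bot x hx); rewrite x0; exact: bs_refl.
Qed.

(** The meet of [a] with a complement of [b] contains no atom, so it is bottom, and distributivity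
    puts [a] below its meet with [b]. *)
Lemma bs_sub_atoms (a b : M) :
  (forall x, lat x -> lsub x a -> lsub x b) -> lsub a b.
Proof.
move=> hab; have [c [[_ _ hbc] [t [ht hjoin]]]] := bs_compl hM b.
have [ab hmab] := bs_meet hM a b; have [ac hmac] := bs_meet hM a c.
have ac0 : ac = lbot.
  apply: contrapT => /(bs_atomic hM)[x [/(bs_At hM) hx xac]].
  case: hmac => h1 h2 _; case: (@bs_atom_in_bot x hx); apply: hbc.
    by apply: hab => //; exact: (bs_trans hM) h1.
  exact: (bs_trans hM) h2.
have hmat : is_meet (@lsub M) a a t.
  by split=> //; exact: bs_refl.
have [_ _ h] := bs_distr hM hjoin hmat hmab hmac.
case: hmab => _ h2 _; apply: (bs_trans hM) h2; apply: h; first exact: bs_refl.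
by rewrite ac0; exact: bs_bot.
Qed.

Lemma bs_sub_atomsP (a b : M) :
  lsub a b <-> forall x, lat x -> lsub x a -> lsub x b.
Proof.
split=> [hab x _ hx|]; [exact: (bs_trans hM) hab|exact: bs_sub_atoms].
Qed.

Lemma bs_union (a b : M) : exists c : M,
  forall x, lat x -> (lsub x c <-> lsub x a \/ lsub x b).
Proof.
have [c hc] := bs_comprehension hM (Or (Subf v0 v1) (Subf v0 v2))
  (scons a (scons b (no_var M))).
by exists c => x hx; rewrite hc // satOr /= !teval_v.
Qed.

Lemma bs_inter (a b : M) : exists c : M,
  forall x, lat x -> (lsub x c <-> lsub x a /\ lsub x b).
Proof.
have [c hc] := bs_comprehension hM (And (Subf v0 v1) (Subf v0 v2))
  (scons a (scons b (no_var M))).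
by exists c => x hx; rewrite hc // satAnd /= !teval_v.
Qed.

Definition is_segment (x X : M) :=
  forall y, lat y -> (lsub y X <-> y = x \/ llhd y x).

Lemma bs_segment (x : M) : exists X, is_segment x X.
Proof.
have [c hc] := bs_comprehension hM (Or (Eqf v0 v1) (Lhdf v0 v1))
  (scons x (no_var M)).
by exists c => y hy; rewrite hc // satOr /= !teval_v.
Qed.

(** The monadic structure of the suborder formed by the atoms in [X]. *)
Definition restr (X : M) : lstruct :=
  @LStruct {Y : M | lsub Y X} (fun Y Z => lsub (sval Y) (sval Z))
    (exist _ lbot (bs_bot hM X)) (fun Y => lat (sval Y))
    (fun Y Z => llhd (sval Y) (sval Z)).

Lemma restr_eq X (Y Z : restr X) : sval Y = sval Z -> Y = Z.
Proof. exact: eq_sig_hprop. Qed.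

Lemma restr_atomic_order X : atomic_order (restr X).
Proof.
split=> /=.
- by move=> a; exact: bs_refl.
- by move=> a b h1 h2; apply/restr_eq/(bs_antisym hM).
- by move=> a; exact: bs_bot.
move=> [a ha] /=; rewrite (bs_At hM); split=> -[h1 h2]; split.
- by case.
- move=> [b hb] /= /h2[b0|ba]; [left|right]; exact: restr_eq.
- by move=> a0; apply: h1; exact: restr_eq.
move=> b ba; have hb : lsub b X by exact: (bs_trans hM ba ha).
by have [[]|[]] := h2 (exist _ b hb) ba; auto.
Qed.

(** A pair of subsets of [J] and [K] corresponds to its union. This is an isomorphism because [J]
    and [K] split the atoms of [I], with [J] before [K]. *)
Lemma styp_restr_split k (I J K : M) :
  (forall u, lat u -> (lsub u I <-> lsub u J \/ lsub u K)) ->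
  (forall u v, lat u -> lat v -> lsub u J -> lsub v K -> llhd u v) ->
  styp k (osum (restr J) (restr K)) = styp k (restr I).
Proof.
move=> hI hJK.
have disj u : lat u -> lsub u J -> ~ lsub u K.
  by move=> hu uJ uK; apply: (bs_lhd_irrefl hM hu); exact: hJK.
pose R (p : osum (restr J) (restr K)) (W : restr I) := forall u, lat u ->
  (lsub u (sval W) <-> lsub u (sval p.1) \/ lsub u (sval p.2)).
have toI u (W : restr I) : lat u -> lsub u (sval W) -> lsub u I.
  by move=> hu uW; apply: (bs_trans hM) uW (svalP W).
have toJ u (W : restr J) : lat u -> lsub u (sval W) -> lsub u J.
  by move=> hu uW; apply: (bs_trans hM) uW (svalP W).
have toK u (W : restr K) : lat u -> lsub u (sval W) -> lsub u K.
  by move=> hu uW; apply: (bs_trans hM) uW (svalP W).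
apply: (@iso_typ _ _ _ _ R) => [||||||[]//].
- by apply: osum_atomic_order; exact: restr_atomic_order.
- exact: restr_atomic_order.
- move=> [Y Z]; have [W hW] := bs_union (sval Y) (sval Z).
  have WI : lsub W I.
    apply: bs_sub_atoms => u hu /(hW u hu)[|] h; apply/hI => //.
      by left; exact: toJ h.
    by right; exact: toK h.
  by exists (exist _ W WI).
- move=> W; have [Y hY] := bs_inter (sval W) J; have [Z hZ] := bs_inter (sval W) K.
  have YJ : lsub Y J by apply: bs_sub_atoms => u hu /hY[].
  have ZK : lsub Z K by apply: bs_sub_atoms => u hu /hZ[].
  exists (exist _ Y YJ, exist _ Z ZK) => u hu /=; rewrite hY // hZ //.
  by have := toI u W hu; rewrite hI //; tauto.
- move=> [Y Z] W [Y' Z'] W' h h' /=; rewrite !bs_sub_atomsP; split.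
    by move=> [h1 h2] u hu /h[]// /= ?; apply/h' => //; auto.
  move=> H; split=> u hu uY.
    have /(H u hu)/(h' u hu)[//|/toK uK] : lsub u (sval W) by apply/h; auto.
    by case: (disj u hu (toJ _ _ hu uY)); exact: uK.
  have /(H u hu)/(h' u hu)[/toJ uJ|//] : lsub u (sval W) by apply/h; auto.
  by case: (disj u hu (uJ hu)); exact: toK uY.
(* An atom of [J] always precedes one of [K], which is the first clause of the order on the sum; the
   reverse would contradict irreflexivity. *)
move=> [Y Z] W [Y' Z'] W' h h' /=; rewrite !(bs_lhd hM); split.
  move=> [[Y0 Z0]|[|] [x [y [hx hy xY yY xy]]]].
  - have /(bs_atomic hM)[x [/(bs_At hM) hx xY]] : sval Y <> lbot.
      by move=> E; apply: Y0; exact: restr_eq.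
    have /(bs_atomic hM)[y [/(bs_At hM) hy yZ]] : sval Z' <> lbot.
      by move=> E; apply: Z0; exact: restr_eq.
    exists x, y; split=> //; [by apply/h; auto|by apply/h'; auto|].
    by apply: hJK => //; [exact: toJ xY|exact: toK yZ].
  - by exists x, y; split=> //; [apply/h; auto|apply/h'; auto].
  by exists x, y; split=> //; [apply/h; auto|apply/h'; auto].
move=> [x [y [hx hy /(h x hx) xW /(h' y hy) yW' xy]]].
case: xW yW' => /= xW [] /= yW.
- by right; left; exists x, y.
- left; split=> E; first by case: (@bs_atom_in_bot x hx); move: xW; rewrite E.
  by case: (@bs_atom_in_bot y hy); move: yW; rewrite E.
- have yx : llhd y x by apply: hJK => //; [exact: toJ yW|exact: toK xW].
  by case: (bs_lhd_irrefl hM hx); exact: (bs_lhd_trans hM hx hy hx).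
by right; right; exists x, y.
Qed.

Lemma styp_restr_top k (t : M) : is_top (@lsub M) t ->
  styp k (restr t) = styp k M.
Proof.
move=> ht; apply: (@iso_typ _ _ _ _ (fun (a : restr t) (b : M) => sval a = b)) => [||||||[]//].
- exact: restr_atomic_order.
- exact: base_atomic_order.
- by move=> a; exists (sval a).
- by move=> a; exists (exist _ a (ht a)).
- by move=> a _ b _ <- <-.
by move=> a _ b _ <- <-.
Qed.

(** The bound is a variable, so that it can itself be quantified; its index is lifted under each
    binder. *)
Fixpoint relativize n (p : formula n) : 'I_n -> formula n :=
  match p with
  | Imp p q => fun i => Imp (relativize p i) (relativize q i)
  | All p => fun i =>
      All (Imp (Subf v0 (Var (lift ord0 i))) (relativize p (lift ord0 i)))
  | p => fun=> p
  end.

Lemma sat_relativize n (p : formula n) X (e : 'I_n -> restr X) i :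
  sval (e i) = X ->
  sat (relativize p i) (fun j => sval (e j)) <-> sat p e.
Proof.
have ht m (f : 'I_m -> restr X) t : teval (fun j => sval (f j)) t = sval (teval f t).
  by case: t.
elim: p e i => {n} [n s t|n s t|n s t|n s|n|n p IHp q IHq|n p IHp] e i he /=;
  rewrite ?ht //.
- by split=> [|->//] ?; exact: restr_eq.
- by rewrite IHp ?IHq.
have hs a (ha : lsub a X) : scons a (fun j => sval (e j)) =
    (fun j => sval (scons (exist _ a ha : restr X) e j)).
  by apply/funext => j; case: (unliftP ord0 j) => [l|] ->; rewrite ?sconsS ?scons0.
split=> H a.
  case: a => a ha; have /= := H a; rewrite teval_v sconsS he => /(_ ha).
  by rewrite (hs _ ha) IHp // sconsS.
by rewrite teval_v sconsS he => ha; rewrite (hs _ ha) IHp // sconsS.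
Qed.

End BaseStruct.

Definition mso (n : nat) : lstruct :=
  @LStruct {set 'I_n} (fun A B => A \subset B) finset.set0 (fun A => exists i, A = [set i]%SET)
    (fun A B => exists i j, [/\ i \in A, j \in B & i < j]).

Lemma mso_lhd1 n (i j : 'I_n) :
  @llhd (mso n) [set i]%SET [set j]%SET <-> i < j.
Proof.
split=> [[k [l []]]|ij]; first by rewrite !inE => /eqP -> /eqP ->.
by exists i, j; rewrite !inE.
Qed.

Lemma mso_atom n (A : mso n) : lat A <-> is_atom (@lsub (mso n)) lbot A.
Proof.
split=> [[i ->]|[A0 hA]].
  split=> [/setP/(_ i)|B]; first by rewrite !inE eqxx.
  by rewrite /= finset.subset1 => /orP[] /eqP ->; auto.
have /finset.set0Pn[i iA] : (A : {set 'I_n}) != finset.set0 by apply/eqP.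
exists i; have [|/eqP|//] := hA [set i]%SET; first by rewrite /= finset.sub1set.
by rewrite -finset.subset0 finset.sub1set inE.
Qed.

Lemma mso_base n : base_struct (mso n).
Proof.
split=> /=.
- by [].
- by move=> a b h1 h2; apply/eqP; rewrite finset.eqEsubset h1 h2.
- by move=> a b c; exact: fintype.subset_trans.
- exact: finset.sub0set.
- by exists [set: 'I_n]%SET; exact: finset.subsetT.
- move=> a b; exists (a :&: b)%SET; split=> /=; [exact: finset.subsetIl|exact: finset.subsetIr|].
  by move=> w h1 h2; rewrite finset.subsetI h1 h2.
- move=> a b; exists (a :|: b)%SET; split=> /=; [exact: finset.subsetUl|exact: finset.subsetUr|].
  by move=> w h1 h2; rewrite finset.subUset h1 h2.
- move=> a b c bc abc ab ac [h1 h2 h3] [k1 k2 k3] [l1 l2 l3] [m1 m2 m3].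
  have sP (A B : {set 'I_n}) : A \subset B -> forall x, x \in A -> x \in B.
    by move/fintype.subsetP.
  split=> [||w hw hw'].
  + by apply: k3 => //; exact: fintype.subset_trans h1.
  + by apply: k3 => //; exact: fintype.subset_trans h2.
  apply/fintype.subsetP => x xabc.
  have bcU : bc \subset (b :|: c)%SET.
    by apply: h3; [exact: finset.subsetUl|exact: finset.subsetUr].
  have xa := sP _ _ k1 x xabc; have := sP _ _ bcU x (sP _ _ k2 x xabc).
  rewrite inE => /orP[] xb.
    apply: (sP _ _ hw); have := l3 [set x]%SET.
    by rewrite !finset.sub1set; exact.
  apply: (sP _ _ hw'); have := m3 [set x]%SET.
  by rewrite !finset.sub1set; exact.
- move=> a; exists (~: a)%SET; split.
    split=> [||w]; rewrite ?finset.sub0set // => h1 h2.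
    by rewrite -(finset.setICr a) finset.subsetI h1 h2.
  exists [set: 'I_n]%SET; split; first exact: finset.subsetT.
  split=> [||w]; rewrite ?finset.subsetT // => h1 h2.
  by rewrite -(finset.setUCr a) finset.subUset h1 h2.
- move=> a /eqP/finset.set0Pn[i ia]; exists [set i]%SET; split; last by rewrite finset.sub1set.
  by apply/(@mso_atom n); exists i.
- exact: mso_atom.
- by move=> a [i ->] /(mso_lhd1 i i); rewrite ltnn.
- move=> a b c [i ->] [j ->] [k ->] /(mso_lhd1 i j) ij /(mso_lhd1 j k) jk.
  by apply/(mso_lhd1 i k); exact: ltn_trans jk.
- move=> a b [i ->] [j ->]; have [ij|ij|ij] := ltngtP i j.
  + by constructor 1; apply/(mso_lhd1 i j).
  + by constructor 3; apply/(mso_lhd1 j i).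
  + by constructor 2; congr [set _]%SET; exact: val_inj.
- move=> a b; split=> [[i [j [ia jb ij]]]|].
    exists [set i]%SET, [set j]%SET; split; rewrite ?finset.sub1set //; [by exists i|by exists j|].
    by apply/(mso_lhd1 i j).
  move=> [_ [_ [[i ->] [j ->]]]]; rewrite !finset.sub1set => ia jb /(mso_lhd1 i j) ij.
  by exists i, j.
move=> m eta e; exists [set i | `[< sat eta (scons ([set i]%SET : mso n) e) >]]%SET.
move=> x [i ->]; rewrite finset.sub1set inE; split=> /asboolP //.
Qed.

Lemma mso_fin n : fin_struct (mso n).
Proof.
split; first exact: mso_base.
- move=> a [i _]; have n0 : 0 < n by case: (n) i => [[]|].
  exists [set Ordinal n0]%SET; split; first by exists (Ordinal n0).
  move=> y [j ->]; case: (posnP j) => j0; last by right; apply/(mso_lhd1 _ j).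
  by left; congr [set _]%SET; exact: val_inj.
- move=> a [i _]; have n0 : n.-1 < n by case: (n) i => [[]|].
  exists [set Ordinal n0]%SET; split; first by exists (Ordinal n0).
  move=> y [j ->]; case: (eqVneq (val j) n.-1) => j0; last first.
    by right; apply/(mso_lhd1 j); rewrite /= ltn_neqAle j0 -ltnS prednK ?ltn_ord //; case: (n) i => [[]|].
  by left; congr [set _]%SET; exact: val_inj.
- move=> _ _ [i ->] [j ->] /(mso_lhd1 i j) ij.
  have iS : i.+1 < n by exact: leq_ltn_trans (ltn_ord j).
  exists [set Ordinal iS]%SET; split; [by exists (Ordinal iS)|exact/(mso_lhd1 i)|].
  move=> [_ [[k ->] /(mso_lhd1 i k) ik /(mso_lhd1 k) /=]].
  by rewrite ltnS leqNgt ik.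
- move=> _ _ [i ->] [j ->] /(mso_lhd1 j i) ji.
  have iS : i.-1 < n by exact: leq_ltn_trans (leq_pred _) (ltn_ord i).
  have i0 : 0 < i by exact: leq_ltn_trans ji.
  exists [set Ordinal iS]%SET; split; [by exists (Ordinal iS)| |].
    by apply/(mso_lhd1 _ i); rewrite /= prednK.
  move=> [_ [[k ->] /(mso_lhd1 _ k) /= ik /(mso_lhd1 k i) ki]].
  by move: ik; rewrite prednK // leqNgt ki.
move=> X /eqP/finset.set0Pn[i0 i0X].
have [i iX imin] := @arg_minnP _ i0 (mem X) val i0X.
exists [set i]%SET; split; [by exists i|by rewrite /= finset.sub1set|].
move=> _ [j ->]; rewrite /= finset.sub1set => /imin; rewrite leq_eqVlt => /predU1P[/val_inj ->|ij].
  by left.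
by right; apply/(mso_lhd1 i j).
Qed.

Lemma mso_atomic_order n : atomic_order (mso n).
Proof. exact/base_atomic_order/mso_base. Qed.

(** Concatenation of finite orders: a set in the long order corresponds to its traces along [lshift]
    and [rshift]. With [osum_styp], equality of types becomes a congruence for addition. *)
Lemma styp_osum_mso k m n : styp k (osum (mso m) (mso n)) = styp k (mso (m + n)).
Proof.
pose R (p : osum (mso m) (mso n)) (C : mso (m + n)) :=
  (forall i, (lshift n i \in (C : {set _})) = (i \in (p.1 : {set _}))) /\
  (forall j, (rshift m j \in (C : {set _})) = (j \in (p.2 : {set _}))).
apply: (@iso_typ _ _ _ _ R) => [||||||[]//].
- by apply: osum_atomic_order; exact: mso_atomic_order.
- exact: mso_atomic_order.
- move=> [A B]; exists (@lshift m n @: A :|: @rshift m n @: B)%SET; split=> i /=.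
    rewrite inE mem_imset; last exact: lshift_inj.
    rewrite [X in _ || X](_ : _ = false) ?orbF //.
    by apply/negP => /imsetP[j _ /eqP]; rewrite eq_lrshift.
  rewrite inE mem_imset; last exact: rshift_inj.
  rewrite [X in X || _](_ : _ = false) //.
  by apply/negP => /imsetP[j _ /eqP]; rewrite eq_rlshift.
- move=> C; exists (@lshift m n @^-1: C, @rshift m n @^-1: C)%SET.
  by split=> i /=; rewrite inE.
- move=> [A B] C [A' B'] C' [h1 h2] [h1' h2'] /=; split.
    move=> [/fintype.subsetP hA /fintype.subsetP hB]; apply/fintype.subsetP => i.
    case: (split_ordP i) => j ->; rewrite ?h1 ?h2 ?h1' ?h2'; [exact: hA|exact: hB].
  move=> /fintype.subsetP H; split; apply/fintype.subsetP => i.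
    by move: (H (lshift n i)); rewrite h1 h1'.
  by move: (H (rshift m i)); rewrite h2 h2'.
move=> [A B] C [A' B'] C' [h1 h2] [h1' h2'] /=; rewrite /= in h1 h2 h1' h2'; split.
  move=> [[/eqP/finset.set0Pn[i iA] /eqP/finset.set0Pn[j jB]]|[|] [i [j [iA jB ij]]]].
  - by exists (lshift n i), (rshift m j); rewrite h1 h2' iA jB /= ltn_addr.
  - by exists (lshift n i), (lshift n j); rewrite h1 h1' iA jB.
  - by exists (rshift m i), (rshift m j); rewrite h2 h2' iA jB /= ltn_add2l.
move=> [i [j []]]; case: (split_ordP i) => {}i ->; case: (split_ordP j) => {}j ->;
  rewrite ?h1 ?h2 ?h1' ?h2' => iA jB /= ij.
- by right; left; exists i, j.
- by left; split; apply/eqP/finset.set0Pn; [exists i|exists j].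
- by move: ij; rewrite ltnNge (leq_trans (ltnW (ltn_ord j))) ?leq_addr.
by right; right; exists i, j; rewrite -(ltn_add2l m).
Qed.

(** * Pseudofiniteness *)

Definition restr_top (M : lstruct) (hM : base_struct M) (X : M) : restr hM X :=
  exist (fun Y => lsub Y X) X (bs_refl hM X).

Lemma restr_bot (M : lstruct) (hM : base_struct M) k :
  styp k (restr hM lbot) = styp k (mso 0).
Proof.
(* Both sides have a single element, so the total relation is an isomorphism. *)
apply: (@iso_typ _ _ _ _ (fun _ _ => True)) => [||||||[]//].
- exact: restr_atomic_order.
- exact: mso_atomic_order.
- by exists finset.set0.
- by exists lbot.
- move=> [a ha] b [a' ha'] b' _ _ /=; split=> _; first by apply/fintype.subsetP => -[].
  exact: (bs_trans hM ha (bs_bot hM a')).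
move=> [a ha] b [a' ha'] b' _ _ /=; split=> [|[[]//]].
rewrite (bs_lhd hM) => -[x [y [hx _ xa _ _]]].
by case: (bs_atom_in_bot hM hx); exact: (bs_trans hM xa ha).
Qed.

Lemma restr_atom (M : lstruct) (hM : base_struct M) k (x : M) : lat x ->
  styp k (restr hM x) = styp k (mso 1).
Proof.
move=> hx; have [x0 hx'] := (bs_At hM x).1 hx.
(* Both algebras have two elements, so it is enough to match the bottoms. *)
pose R (Y : restr hM x) (A : mso 1) := sval Y = lbot <-> A = finset.set0.
have cA (A : {set 'I_1}) : A = finset.set0 \/ A = [set ord0]%SET.
  have : (A \subset [set ord0])%SET by apply/fintype.subsetP => i _; rewrite ord1 inE.
  by rewrite finset.subset1 => /orP[] /eqP ->; auto.
have n1 : [set ord0 : 'I_1]%SET <> finset.set0.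
  by move/setP/(_ ord0); rewrite !inE.
apply: (@iso_typ _ _ _ _ R) => [||||||[]//].
- exact: restr_atomic_order.
- exact: mso_atomic_order.
- move=> [Y hY]; case: (hx' Y hY) => Y0.
    by exists finset.set0; split.
  by exists [set ord0]%SET; rewrite /R /= Y0; split.
- move=> A; case: (cA A) => ->; first by exists lbot; split.
  by exists (restr_top hM x); split.
- move=> [Y hY] A [Y' hY'] A' hA hA'; rewrite /R /= in hA hA' *.
  case: (cA A) hA => ->; case: (cA A') hA' => -> hA' hA.
  + by rewrite hA.2 // finset.sub0set; split=> // _; exact: bs_bot.
  + by rewrite hA.2 // finset.sub0set; split=> // _; exact: bs_bot.
  + rewrite hA'.2 // finset.subset0; split=> [h|/eqP//].
    by case: n1; apply/hA; apply: (bs_antisym hM) => //; exact: bs_bot.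
  case: (hx' Y hY) => [/hA//|->]; case: (hx' Y' hY') => [/hA'//|->].
  by split=> // _; exact: bs_refl.
move=> [Y hY] A [Y' hY'] A' _ _ /=; split=> [|[i [j []]]]; last by rewrite !ord1.
rewrite (bs_lhd hM) => -[u [v [hu hv uY vY uv]]].
have E := bs_atom_sub hM hv hx (bs_trans hM vY hY').
have E' := bs_atom_sub hM hu hx (bs_trans hM uY hY).
by case: (bs_lhd_irrefl hM hx); rewrite -{1}E' -E.
Qed.

Lemma definable_mso k : exists q : sentence, forall M : lstruct,
  M |= q <-> exists n, styp k M = styp k (mso n).
Proof.
have [q hq] := definable_typ (fun t : tp k 0 => exists n, t = styp k (mso n)).
by exists q => M; exact: hq.
Qed.

(** An induction along the atoms, which [fs_least] allows because comprehension collects the bad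
    endpoints into a set. *)
Lemma fin_pseudofinite (M : lstruct) k : fin_struct M ->
  exists n, styp k M = styp k (mso n).
Proof.
move=> hF; have hM := fs_base hF.
have [q hq] := definable_mso k.
(* [relativize] needs a variable for the bound, so [q] is first read as a formula in one variable.
   In [q'], variable 0 is the bound and variable 1 the endpoint. *)
pose q' : formula 2 := fren (fun _ : 'I_1 => ord0 : 'I_2)
  (relativize (fren (fun _ : 'I_0 => ord0 : 'I_1) q) ord0).
have hq' X (e : 'I_1 -> M) : sat q' (scons X e) <-> restr hM X |= q.
  rewrite sat_fren.
  rewrite (_ : _ \o _ = (fun j => sval
    ((fun _ : 'I_1 => restr_top hM X) j))).
    rewrite sat_relativize // sat_fren.
    by rewrite (_ : _ \o _ = (fun=> lbot)) //; apply/funext => -[].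
  by apply/funext => i /=; rewrite scons0.
pose good x := forall X, is_segment x X -> restr hM X |= q.
pose seg : formula 2 := AllAt (Iff (Subf v0 v1) (Or (Eqf v0 v2) (Lhdf v0 v2))).
have hseg x X : sat seg (scons X (scons x (no_var M))) <-> is_segment x X.
  rewrite satAllAt; split=> H y hy; have := H y hy.
    by rewrite satIff satOr /= !teval_v.
  by rewrite satIff satOr /= !teval_v.
have [B hB] := bs_comprehension hM (Not (All (Imp seg q'))) (no_var M).
have {}hB x : lat x -> (lsub x B <-> ~ good x).
  move=> /hB ->; rewrite satNot satAll; split=> H H'; apply: H => X.
    by rewrite satImp hseg hq'; exact: H'.
  by have := H' X; rewrite satImp hseg hq'.
have all_good x : lat x -> good x.
  apply: contrapT => nx.
  have /(fs_least hF)[{nx}x [hx /hB -/(_ hx) xB xmin]] : B <> lbot.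
    move=> B0; apply: nx => hx; apply: contrapT => /hB -/(_ hx).
    by rewrite B0; exact: bs_atom_in_bot.
  apply: xB => X hX.
  (* [J] is the part strictly below [x]: the segment of the predecessor, good by minimality of [x],
     or empty if [x] is the first atom. *)
  have [J [hJ [n hn]]] : exists J,
      (forall u, lat u -> (lsub u J <-> llhd u x)) /\
      exists n, styp k (restr hM J) = styp k (mso n).
    have [[y [hy yx]]|ny] := pselect (exists y, lat y /\ llhd y x).
      have [s [hs sx ns]] := fs_pred hF hx hy yx.
      have [J hJ] := bs_segment hM s; exists J; split.
        move=> u hu; rewrite hJ //; split=> [[->//|us]|ux].
          exact: (bs_lhd_trans hM hu hs hx).
        case: (bs_lhd_total hM hu hs) => [|->|su]; [by right|by left|].
        by case: ns; exists u.
      suff gs : good s by have /hq := gs J hJ.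
      apply: contrapT => /hB -/(_ hs)/xmin -/(_ hs)[sx'|xs].
        by apply: (bs_lhd_irrefl hM hx); rewrite -{1}sx'.
      by apply: (bs_lhd_irrefl hM hx); exact: (bs_lhd_trans hM hx hs hx).
    exists lbot; split; last by exists 0; exact: restr_bot.
    move=> u hu; split=> [h|ux]; first by case: (bs_atom_in_bot hM hu h).
    by case: ny; exists u.
  (* The segment of [x] is [J] followed by one point. *)
  apply/hq; exists (n + 1); rewrite -(styp_osum_mso k n 1).
  rewrite -(@styp_restr_split _ hM k X J x).
  - apply: osum_styp => //; try exact: restr_atomic_order;
      try exact: mso_atomic_order; exact: restr_atom.
  - move=> u hu; rewrite (hX u hu) (hJ u hu); split=> -[]; auto.
      by move=> ->; right; exact: bs_refl.
    by move/(bs_atom_sub hM hu hx); auto.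
  by move=> u v hu hv /(hJ u hu) ux /(bs_atom_sub hM hv hx) ->.
(* The segment of the last atom is all of [M]; without atoms, [M] is its restriction to bottom. *)
have [[x hx]|nx] := pselect (exists x : M, lat x).
  have [l [hl lmax]] := fs_last hF hx; have [X hX] := bs_segment hM l.
  have /hq[n hn] := all_good l hl X hX; exists n; rewrite -hn.
  apply/esym/styp_restr_top => a; apply: (bs_sub_atoms hM) => u hu _.
  by apply/hX => //; case: (lmax u hu); auto.
exists 0; rewrite -(restr_bot hM); apply/esym/styp_restr_top => a.
by apply: (bs_sub_atoms hM) => u hu; case: nx; exists u.
Qed.

(** * Compactness *)

Section Ultraproduct.
Variables (M : nat -> lstruct) (U : set_system nat).
Hypothesis hU : UltraFilter U.

Let seqs := forall k, M k.

Definition ultra_class (f : seqs) : set seqs := [set g | U [set k | f k = g k]].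

Definition ultra_dom := {A : set seqs | exists f, A = ultra_class f}.

Definition ultra_cls (f : seqs) : ultra_dom :=
  exist _ (ultra_class f) (ex_intro _ f erefl).

Lemma ultra_clsP f g : ultra_cls f = ultra_cls g <-> U [set k | f k = g k].
Proof.
split=> [/(congr1 sval)/= E|h].
  have : ultra_class g g by rewrite /ultra_class /=; apply: filterE.
  by rewrite -E.
apply: eq_sig_hprop; first by move=> *; exact: Prop_irrelevance.
apply/seteqP; split=> u hu; rewrite /= /ultra_class /= in hu h *.
  by apply: filterS2 h hu => k /= -> ->.
by apply: filterS2 h hu => k /= -> ->.
Qed.

Lemma ultra_cls_surj (a : ultra_dom) : exists f, a = ultra_cls f.
Proof.
by case: a => A [f E]; exists f; exact: eq_sig_hprop.
Qed.

Definition ultra_lift2 (Q : forall k, M k -> M k -> Prop) (a b : ultra_dom) :=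
  exists f g, [/\ a = ultra_cls f, b = ultra_cls g & U [set k | Q k (f k) (g k)]].

Lemma ultra_lift2P Q f g :
  ultra_lift2 Q (ultra_cls f) (ultra_cls g) <-> U [set k | Q k (f k) (g k)].
Proof.
split=> [[f' [g' [/ultra_clsP hf /ultra_clsP hg h]]]|h]; last by exists f, g.
by apply: filterS3 hf hg h => k /= -> ->.
Qed.

(** [lat] is lifted as a binary relation on a doubled argument, so that [ultra_lift2P] covers all
    three predicates. *)
Definition ultraproduct : lstruct :=
  @LStruct ultra_dom (ultra_lift2 (fun k => @lsub (M k)))
    (ultra_cls (fun k => lbot)) (fun a => ultra_lift2 (fun k a _ => lat a) a a)
    (ultra_lift2 (fun k => @llhd (M k))).

(** The theorem of Los: implication uses that [U] decides every set, and the quantifier uses choice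
    in the factors. *)
Lemma ultraproduct_los n (p : formula n) (f : 'I_n -> seqs) :
  sat p (fun i => ultra_cls (f i) : ultraproduct) <->
  U [set k | sat p (fun i => f i k)].
Proof.
have ht m (g : 'I_m -> seqs) (t : term m) :
    teval (fun i => ultra_cls (g i) : ultraproduct) t =
    ultra_cls (fun k => teval (fun i => g i k) t) by case: t.
have hneg A : U (~` A) -> ~ U A.
  move=> hn hA; apply: (@filter_not_empty _ U).
  by apply: filterS2 hn hA.
elim: p f => {n} [n s t|n s t|n s t|n s|n|n p IHp q IHq|n p IHp] f /=; rewrite ?ht.
- exact: ultra_clsP.
- exact: ultra_lift2P.
- exact: ultra_lift2P.
- exact: ultra_lift2P.
- by split=> // h; apply: (@filter_not_empty _ U); exact: filterS h.
- rewrite IHp IHq; split=> [H|H hp]; last by apply: filterS2 H hp => k; exact.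
  have [/H|hn] := in_ultra_setVsetC [set k | sat p (fun i => f i k)] hU.
    by apply: filterS => k ? _.
  by apply: filterS hn => k np /np.
have hs (a : seqs) : scons (ultra_cls a : ultraproduct) (fun i => ultra_cls (f i)) =
    (fun i => ultra_cls (scons a f i)).
  by apply/funext => i; rewrite /scons; case: (unlift ord0 i).
have hk (a : seqs) k : (fun i => scons a f i k) = scons (a k) (fun i => f i k).
  by apply/funext => i; rewrite /scons; case: (unlift ord0 i).
split=> [H|H a]; last first.
  have [g ->] := ultra_cls_surj a; rewrite hs IHp.
  by apply: filterS H => k /= H; rewrite hk.
(* The point chosen in each factor is a counterexample whenever there is one, so truth at these
   points gives truth everywhere. *)
have ex : forall k, exists b : M k,
    sat p (scons b (fun i => f i k)) -> forall b, sat p (scons b (fun i => f i k)).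
  move=> k; have [h|/existsNP[b hb]] := pselect (forall b, sat p (scons b (fun i => f i k))).
    by exists lbot.
  by exists b.
have := H (ultra_cls (fun k => sval (cid (ex k)))); rewrite hs IHp.
by apply: filterS => k /=; rewrite hk; exact: svalP (cid (ex k)).
Qed.

End Ultraproduct.

(** Having the type of [mso (n k)] at depth k is a sentence, true in all factors from index k on,
    hence in an ultraproduct along an ultrafilter refining [\oo]. *)
Lemma mso_compactness (n : nat -> nat) :
  (forall j k, j <= k -> styp j (mso (n k)) = styp j (mso (n j))) ->
  exists M : lstruct, forall k, styp k M = styp k (mso (n k)).
Proof.
move=> hn; have [U [hU leU]] := ultraFilterLemma (F := \oo) _.
exists (ultraproduct (fun k => mso (n k)) U) => k.
have [q hq] := definable_typ (fun t => t = styp k (mso (n k))).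
apply/hq.
have -> : no_var (ultraproduct (fun k => mso (n k)) U) =
    (fun i => ultra_cls U (fun k => no_var (mso (n k)) i)).
  by apply/funext => -[].
apply/ultraproduct_los => //; apply: leU; exists k => // j /= kj.
by apply/hq; exact: hn.
Qed.

(** * Counting modulo in finite structures *)

(** [y] is reached from [x] by [b] immediate successor steps. *)
Fixpoint shifted (M : lstruct) (b : nat) (x y : M) : Prop :=
  if b is b'.+1 then exists z, (llhd x z /\
    ~ exists w, lat w /\ llhd x w /\ llhd w z) /\ (lat z /\ shifted b' z y)
  else x = y.

Lemma definable_shifted b n (i j : 'I_n) :
  definable (fun M e => shifted b (e i) (e j)).
Proof.
elim: b n i j => [|b IHb] n i j; first by exists (Eqf (Var i) (Var j)).
have [p hp] := IHb n.+1 ord0 (lift ord0 j).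
exists (Ex (And (And (Lhdf (Var (lift ord0 i)) v0)
  (Not (ExAt (And (Lhdf (Var (lift ord0 (lift ord0 i))) v0) (Lhdf v0 v1)))))
  (And (Atf v0) p))) => M e.
rewrite satEx [X in _ <-> X]/=.
have hw z : sat (ExAt (And (Lhdf (Var (lift ord0 (lift ord0 i))) v0) (Lhdf v0 v1)))
    (scons z e) <-> exists w, lat w /\ llhd (e i) w /\ llhd w z.
  by rewrite satExAt; split=> -[w [hw h]]; exists w; split=> //;
    move: h; rewrite satAnd /= !sconsS !teval_v.
have hz z : sat (And (And (Lhdf (Var (lift ord0 i)) v0) (Not (ExAt (And
    (Lhdf (Var (lift ord0 (lift ord0 i))) v0) (Lhdf v0 v1))))) (And (Atf v0) p))
    (scons z e) <-> (llhd (e i) z /\ ~ exists w, lat w /\ llhd (e i) w /\ llhd w z) /\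
    (lat z /\ shifted b z (e j)).
  by rewrite !satAnd satNot hw hp /= !sconsS !scons0.
by split=> -[z /hz hz']; exists z.
Qed.

Lemma mso_shifted n b (i : 'I_n) (y : mso n) :
  shifted b ([set i]%SET : mso n) y <-> exists j : 'I_n, y = [set j]%SET /\ j = i + b :> nat.
Proof.
elim: b i y => [|b IHb] i y /=.
  split=> [<-|[j [-> E]]]; first by exists i; rewrite addn0.
  by congr [set _]%SET; apply: val_inj; rewrite /= E addn0.
split=> [[z [[ij nw] [[j zE] hz]]]|[j [-> ji]]].
  move: hz ij nw; rewrite {}zE => /IHb[l [-> lj]] ij nw.
  move/(mso_lhd1 i j): ij => ij; exists l; split=> //; rewrite lj addnS -addSn.
  congr (_ + _); apply/eqP; rewrite eqn_leq ij andbT leqNgt; apply/negP => iSj.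
  have iS : i.+1 < n by exact: ltn_trans (ltn_ord j).
  apply: nw; exists [set Ordinal iS]%SET; split; first by exists (Ordinal iS).
  by split; [apply/(mso_lhd1 i)|apply/(mso_lhd1 _ j)].
have iS : i.+1 < n.
  by apply: leq_ltn_trans (ltn_ord j); rewrite ji addnS ltnS leq_addr.
exists [set Ordinal iS]%SET; split.
  split; first exact/(mso_lhd1 i).
  move=> [_ [[w ->] [/(mso_lhd1 i w) iw /(mso_lhd1 w) /=]]].
  by rewrite ltnS leqNgt iw.
split; first by exists (Ordinal iS).
by apply/IHb; exists j; rewrite /= addSnnS.
Qed.

(* Finiteness forces the chain [x, x + b, x + 2 b, ...] in [X] from the first
   atom to stop, which it can do only at [r - 1] steps before the last one. *)
Definition progression (r b : nat) (M : lstruct) := exists X : M,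
  (exists x, lat x /\ lsub x X /\ forall z, lat z -> ~ llhd z x) /\
  forall x, lat x -> lsub x X ->
    (exists y, lat y /\ lsub y X /\ shifted b x y) \/
    (exists y, lat y /\ shifted r.-1 x y /\ forall z, lat z -> ~ llhd y z).

Lemma definable_progression r b :
  exists q : sentence, forall M, M |= q <-> progression r b M.
Proof.
(* The innermost context holds [y], [x] and [X] at indices 0, 1 and 2. *)
have [pb hpb] := @definable_shifted b 3 o1 ord0.
have [pr hpr] := @definable_shifted r.-1 3 o1 ord0.
exists (Ex (And (ExAt (And (Subf v0 v1) (AllAt (Not (Lhdf v0 v1)))))
  (AllAt (Imp (Subf v0 v1) (Or (ExAt (And (Subf v0 v2) pb))
     (ExAt (And pr (AllAt (Not (Lhdf v1 v0)))))))))) => M.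
rewrite /satisfies satEx; split=> -[X].
  rewrite satAnd satExAt satAllAt => -[[x [hx /satAnd[xX /satAllAt xm]]] hX].
  exists X; split.
    exists x; split=> //; split; first by move: xX; rewrite /= !teval_v.
    by move=> z /xm; rewrite satNot /= !teval_v.
  move=> y hy yX; have /satImp H := hX y hy.
  have /satOr[] := H (ltac:(by rewrite /= !teval_v)) => /satExAt[z [hz /satAnd[]]];
    rewrite ?hpb ?hpr.
    by rewrite /= !teval_v => zX yz; left; exists z.
  rewrite !teval_v => yz /satAllAt ym; right; exists z; split=> //; split=> //.
  by move=> w /ym; rewrite satNot /= !teval_v.
move=> [[x [hx [xX xm]]] hX]; exists X; rewrite satAnd satExAt satAllAt; split.
  exists x; split=> //; rewrite satAnd satAllAt; split; first by rewrite /= !teval_v.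
  by move=> z /xm; rewrite satNot /= !teval_v.
move=> y hy; rewrite satImp satOr !satExAt => yX.
have {}yX : lsub y X by move: yX; rewrite /= !teval_v.
case: (hX y hy yX) => -[z [hz [h1 h2]]]; [left|right]; exists z; split=> //;
  rewrite satAnd ?hpb ?hpr ?satAllAt; split; rewrite ?teval_v //.
  by rewrite /= !teval_v.
by move=> w /h2; rewrite satNot /= !teval_v.
Qed.

(** From point 0, steps of length [b] must stop, at a point i with i + r = n: the last point n - 1
    is [r.-1] steps away, whence [r] is positive. Conversely, the multiples of [b] up to [j * b]
    form a suitable set. *)
Lemma progression_mso r b n : 0 < r -> 0 < b ->
  progression r b (mso n) <-> exists j, n = r + j * b.
Proof.
move=> r0 b0.
transitivity (exists X : {set 'I_n}, (exists i, i \in X /\ forall j : 'I_n, ~ j < i) /\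
   forall i, i \in X -> (exists j, j \in X /\ j = i + b :> nat) \/ i + r = n).
  split=> -[X].
    move=> [[_ [[i ->] [iX hi]]] hX]; exists X.
    have {}iX : i \in (X : {set _}) by move: iX; rewrite /= finset.sub1set.
    split.
      exists i; split=> // j ji; apply: (hi [set j]%SET); first by exists j.
      exact/(mso_lhd1 j i).
    move=> j jX; case: (hX [set j]%SET); first by exists j.
    - by rewrite /= finset.sub1set.
    - move=> [_ [[l ->] [lX /mso_shifted[l' [/finset.set1_inj <- ?]]]]].
      by left; exists l; split=> //; move: lX; rewrite /= finset.sub1set.
    move=> [_ [[l ->] [/mso_shifted[l' [/finset.set1_inj <- hl] hl']]]].
    right; apply/eqP; rewrite eqn_leq -{1}(prednK r0) addnS -hl ltn_ord /=.
    rewrite leqNgt; apply/negP => lt.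
    have hlt : l.+1 < n by rewrite hl -addnS prednK.
    apply: (hl' [set Ordinal hlt]%SET); first by exists (Ordinal hlt).
    exact/(mso_lhd1 l).
  move=> [[i [iX hi]] hX]; exists (X : mso n); split.
    exists [set i]%SET; split; first by exists i.
    split; first by rewrite /= finset.sub1set.
    by move=> _ [j ->] /(mso_lhd1 j i); exact: hi.
  move=> _ [j ->]; rewrite /= finset.sub1set.
  case/hX => [[l [lX lj]]|jr]; [left|right].
    exists [set l]%SET; split; first by exists l.
    rewrite finset.sub1set; split=> //.
    by apply/mso_shifted; exists l.
  have lt : j + r.-1 < n by rewrite -addnS prednK // jr.
  exists [set Ordinal lt]%SET; split; first by exists (Ordinal lt).
  split; first by apply/mso_shifted; exists (Ordinal lt).
  move=> _ [m ->] /(mso_lhd1 (Ordinal lt) m); rewrite /= -addnS prednK // jr => h.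
  by move: (ltn_ord m); rewrite ltnNge h.
split=> [[X [[i [iX hi]] hX]]|[j nE]].
  have i0 : i = 0 :> nat.
    apply/eqP; rewrite -leqn0 leqNgt; apply/negP => i0.
    by case: (hi (Ordinal (leq_ltn_trans (leq0n i) (ltn_ord i)))).
  (* Induction on the distance to the end, which decreases because [b] is positive. *)
  suff H d (l : 'I_n) : n - l <= d -> l \in X -> exists j, n = l + r + j * b.
    by have [j E] := H _ i (leqnn _) iX; exists j; rewrite i0 in E.
  elim: d l => [|d IHd] l; first by rewrite leqn0 subn_eq0 leqNgt ltn_ord.
  move=> hd /hX[[l' [l'X l'E]]|lE]; last by exists 0; rewrite addn0 lE.
  have [||j E] := IHd l' => //.
    rewrite l'E subnDA leq_subLR (leq_trans hd) // addnC -addn1 leq_add2l //.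
  exists j.+1; apply: etrans E _; rewrite l'E mulSn !addnA; congr (_ + _).
  by rewrite addnAC.
have lt0 : 0 < n by rewrite nE addn_gt0 r0.
exists [set i : 'I_n | `[< exists2 c, c <= j & i = c * b :> nat >]]%SET; split.
  exists (Ordinal lt0); split=> //; rewrite inE; apply/asboolP.
  by exists 0; rewrite ?mul0n.
move=> i; rewrite inE => /asboolP[c cj iE].
move: cj; rewrite leq_eqVlt => /predU1P[cj|cj]; first by right; rewrite iE cj nE addnC.
have lt : c.+1 * b < n.
  by rewrite nE -{1}(add0n (c.+1 * b)) -addSn leq_add // leq_mul.
left; exists (Ordinal lt); rewrite inE /= iE mulSn addnC; split=> //.
by apply/asboolP; exists c.+1; rewrite ?mulSn 1?addnC.
Qed.

Lemma mso_count r b : 0 < r -> 0 < b ->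
  exists q : sentence, forall n, mso n |= q <-> exists j, n = r + j * b.
Proof.
move=> r0 b0; have [q hq] := definable_progression r b.
by exists q => n; rewrite hq; exact: progression_mso.
Qed.

(** * Powers in finite monoids are determined by types *)

Lemma expg_eventually_periodic (S : finMonoidType) (s : S) : exists i b,
  0 < b /\ forall n, i <= n -> forall c, (s ^+ (n + c * b) = s ^+ n)%g.
Proof.
(* By pigeonhole, two of the first [#|S|.+1] powers agree; their distance is the period. *)
have [i [j [ij E]]] : exists i j, i < j /\ (s ^+ i = s ^+ j)%g.
  have : ~~ injectiveb (fun i : 'I_#|S|.+1 => (s ^+ i)%g).
    by apply/injectiveP => /leq_card; rewrite card_ord ltnn.
  case/injectivePn => i [j ij E]; case: (ltngtP i j) => h.
  - by exists i, j.
  - by exists j, i.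
  by move/val_inj: h ij => ->; rewrite eqxx.
have period e : (s ^+ (i + (j - i) + e) = s ^+ (i + e))%g.
  by rewrite subnKC ?(ltnW ij) // !expgnDr E.
exists i, (j - i); rewrite subn_gt0; split=> // n /subnKC <- c.
elim: c => [|c IHc]; first by rewrite addn0.
by rewrite mulSn addnACA period addnA.
Qed.

(** Exponents up to the preperiod are recovered exactly, from membership in the sets r + nat; larger
    ones only modulo [b], from membership in r + b nat. *)
Lemma styp_expg (S : finMonoidType) (s : S) : exists k, forall m n,
  styp k (mso m) = styp k (mso n) -> (s ^+ m = s ^+ n)%g.
Proof.
have [i [b [b0 hper]]] := expg_eventually_periodic s.
(* [mso_count] asks for positive numbers; other pairs receive the default [Fls]. *)
have /choice[q hq] : forall rb : nat * nat, exists q : sentence,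
    0 < rb.1 -> 0 < rb.2 -> forall n, mso n |= q <-> exists j, n = rb.1 + j * rb.2.
  case=> r c; case: (posnP r) => r0; first by exists Fls; rewrite r0.
  case: (posnP c) => c0; first by exists Fls; rewrite c0.
  by have [q hq] := mso_count r0 c0; exists q.
(* The offsets used below are at most n + 1 with n <= i, or i + 1 plus a remainder modulo [b]; all
   lie in this range. *)
pose k := \max_(r < (i + b).+2) maxn (depth (q (val r, 1))) (depth (q (val r, b))).
exists k => m n E.
have transfer r c : 0 < r -> 0 < c -> r < (i + b).+2 -> c = 1 \/ c = b ->
    (exists j, m = r + j * c) <-> (exists j, n = r + j * c).
  move=> r0 c0 rl cE; rewrite -!(hq (r, c)) //; apply: (styp_satisfies (k := k)) => //.
  apply: leq_trans (leq_bigmax (Ordinal rl)).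
  by case: cE => -> /=; rewrite ?leq_maxl ?leq_maxr.
have ge r : (exists j, m = r + j * 1) <-> r <= m.
  split=> [[j ->]|rm]; first exact: leq_addr.
  by exists (m - r); rewrite muln1 subnKC.
have hr c r : 0 < r -> 0 < c -> r < (i + b).+2 -> c = 1 \/ c = b ->
    (exists j, n = r + j * c) -> exists j, m = r + j * c.
  by move=> r0 c0 rl cE; rewrite transfer.
(* If n <= i, then m = n: m is not in n + 1 + nat and, unless n = 0, it is in n + nat. *)
case: (leqP n i) => ni.
  congr (_ ^+ _)%g; apply/eqP; rewrite eqn_leq; apply/andP; split.
    rewrite leqNgt; apply/negP => /ge; rewrite transfer //; last by left.
      by move=> [j E']; have := leq_addr (j * 1) n.+1; rewrite -E' ltnn.
    by rewrite ltnS ltnS (leq_trans ni) // leq_addr.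
  case: (posnP n) => [->//|n0]; apply/ge/hr => //; last by exists 0; rewrite addn0.
    by rewrite ltnS (leq_trans ni) // leqW // leq_addr.
  by left.
(* A representative of [n] modulo [b] inside the periodic range; both powers equal the one with
   exponent [r]. *)
pose r := i.+1 + (n - i.+1) %% b.
have nE : n = r + (n - i.+1) %/ b * b.
  by rewrite /r -addnA (addnC _ (_ * b)) -divn_eq subnKC.
have [|||||j mE] := hr b r => //.
- by rewrite /r addSn !ltnS leq_add2l ltnW // ltn_pmod.
- by right.
- by exists ((n - i.+1) %/ b).
rewrite mE nE !hper // /r addSn.
  by rewrite leqW // leq_addr.
by rewrite leqW // leq_addr.
Qed.

(** * The space of theories *)

Lemma S0_eq (T U : S0) : thy T = thy U -> T = U.
Proof.
case: T U => T c1 c2 c3 [U c1' c2' c3'] /= E; move: c1 c2 c3; rewrite E => *.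
by congr MkS0; exact: Prop_irrelevance.
Qed.

Lemma S0_Th (T : S0) (M : lstruct) : models M T -> thy T = Th M.
Proof.
move=> hM; apply/seteqP; split=> p; first exact: hM.
by move=> hp; case: (thy_complete T p) => // /hM /(_ hp).
Qed.

Lemma S0_clopenP (p : sentence) (T : S0) : S0_clopen p T <-> thy T p.
Proof.
split=> [h|Tp M]; last exact.
by have [M hM] := thy_consistent T; rewrite (S0_Th hM); exact: h.
Qed.

Definition S0_of (M : lstruct) (hM : fin_struct M) : S0.
Proof.
apply: (@MkS0 (Th M)).
- by move=> p; case: (pselect (M |= p)) => h; [left|right].
- by exists M.
- exact/T_MSOFinP.
Defined.

Definition S0_model (T : S0) : lstruct := sval (cid (thy_consistent T)).

Lemma S0_modelP (T : S0) : models (S0_model T) T.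
Proof. exact: svalP (cid (thy_consistent T)). Qed.
Arguments S0_modelP : clear implicits.

Lemma S0_model_fin (T : S0) : fin_struct (S0_model T).
Proof. by apply/T_MSOFinP => p /(@thy_extends T); exact: S0_modelP. Qed.

(** Independent of the chosen model, by [stp_models]. *)
Definition stp k (T : S0) : tp k 0 := styp k (S0_model T).

(** Each type is pinned down by a sentence, and each sentence is decided by the type at its own
    depth. *)
Lemma Th_styp (M N : lstruct) : Th M = Th N <-> forall k, styp k M = styp k N.
Proof.
split=> [E k|E].
  have [q hq] := definable_typ (fun t => t = styp k N).
  by apply/hq; rewrite -[sat _ _]/(Th M q) E; apply/hq.
by apply/seteqP; split=> p; have [] := styp_satisfies (leqnn (depth p)) (E (depth p)).
Qed.

Lemma stp_models k (T : S0) (M : lstruct) : models M T -> stp k T = styp k M.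
Proof.
by move=> /S0_Th E; have := S0_Th (S0_modelP T); rewrite E => /Th_styp h; exact/esym/h.
Qed.

Lemma S0_ext (T U : S0) : (forall k, stp k T = stp k U) -> T = U.
Proof.
move=> h; apply: S0_eq; rewrite (S0_Th (S0_modelP T)) (S0_Th (S0_modelP U)).
exact/Th_styp.
Qed.

Lemma stp_mso k (T : S0) : exists n, stp k T = styp k (mso n).
Proof. exact/fin_pseudofinite/S0_model_fin. Qed.

Lemma fin_atomic_order M : fin_struct M -> atomic_order M.
Proof. by move=> h; apply/base_atomic_order/fs_base. Qed.

(** Axioms are checked one at a time: at the depth of an axiom, the sum has the type of some
    [mso (m + n)], where it holds. *)
Lemma osum_fin (M N : lstruct) : fin_struct M -> fin_struct N ->
  fin_struct (osum M N).
Proof.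
move=> hM hN; apply/T_MSOFinP => p Tp.
have [m hm] := fin_pseudofinite (depth p) hM.
have [n hn] := fin_pseudofinite (depth p) hN.
suff E : styp (depth p) (osum M N) = styp (depth p) (mso (m + n)).
  by apply/(styp_satisfies _ E) => //; move: (mso_fin (m + n)) => /T_MSOFinP; exact.
rewrite -styp_osum_mso; apply: osum_styp => //; try exact: fin_atomic_order;
  exact: mso_atomic_order.
Qed.

Definition oplus (T U : S0) : S0 :=
  S0_of (osum_fin (S0_model_fin T) (S0_model_fin U)).

Lemma stp_oplus k (T U : S0) :
  stp k (oplus T U) = styp k (osum (S0_model T) (S0_model U)).
Proof. by apply: stp_models => p. Qed.

Lemma stp_oplus_eq k (T U T' U' : S0) : stp k T = stp k T' -> stp k U = stp k U' ->
  stp k (oplus T U) = stp k (oplus T' U').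
Proof.
by move=> hT hU; rewrite !stp_oplus; apply: osum_styp => //;
  apply/fin_atomic_order/S0_model_fin.
Qed.

(** At each depth, the sum of theories is an addition of natural numbers; the monoid laws then
    follow by [S0_ext]. *)
Lemma stp_oplus_mso k (T U : S0) m n :
  stp k T = styp k (mso m) -> stp k U = styp k (mso n) ->
  stp k (oplus T U) = styp k (mso (m + n)).
Proof.
move=> hT hU; rewrite stp_oplus -styp_osum_mso.
by apply: osum_styp => //; try exact: mso_atomic_order;
  apply/fin_atomic_order/S0_model_fin.
Qed.

Lemma oplusP : is_oplus oplus.
Proof.
move=> T U M N hM hN; rewrite (S0_Th (S0_modelP (oplus T U))); apply/Th_styp => k.
have hF K (V : S0) : models K V -> atomic_order K.
  move=> hK; apply/fin_atomic_order/T_MSOFinP => p /(@thy_extends V).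
  exact: hK.
rewrite -/(stp k _) stp_oplus; apply: osum_styp; first exact: (hF _ T (S0_modelP T)).
- exact: (hF _ U (S0_modelP U)).
- exact: hF hM.
- exact: hF hN.
- exact: stp_models.
exact: stp_models.
Qed.

Definition S0_mso (n : nat) : S0 := S0_of (mso_fin n).

Lemma stp_S0_mso k n : stp k (S0_mso n) = styp k (mso n).
Proof. by apply: stp_models => p. Qed.

Lemma S0_msoD m n : oplus (S0_mso m) (S0_mso n) = S0_mso (m + n).
Proof.
by apply: S0_ext => k; rewrite stp_S0_mso; apply: stp_oplus_mso; exact: stp_S0_mso.
Qed.

Lemma oplusA : associative oplus.
Proof.
move=> T U V; apply: S0_ext => k.
have [l hl] := stp_mso k T; have [m hm] := stp_mso k U; have [n hn] := stp_mso k V.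
rewrite (stp_oplus_mso hl (stp_oplus_mso hm hn)).
by rewrite (stp_oplus_mso (stp_oplus_mso hl hm) hn) addnA.
Qed.

Lemma oplus0l : left_id (S0_mso 0) oplus.
Proof.
move=> T; apply: S0_ext => k; have [n hn] := stp_mso k T.
by rewrite (stp_oplus_mso (stp_S0_mso k 0) hn).
Qed.

Lemma oplus0r : right_id (S0_mso 0) oplus.
Proof.
move=> T; apply: S0_ext => k; have [n hn] := stp_mso k T.
by rewrite (stp_oplus_mso hn (stp_S0_mso k 0)) addn0.
Qed.

(** The theories with a given type form a basic clopen set, since a sentence expresses the type;
    conversely a sentence depends only on the type at its depth. *)
Lemma S0_nbhsP (T : S0) (A : set S0) :
  nbhs T A <-> exists k, forall U, stp k U = stp k T -> A U.
Proof.
split=> [|[k hk]].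
  rewrite nbhsE => -[B [[D _ <-] [p Dp /S0_clopenP Tp]] BA].
  exists (depth p) => U E; apply: BA; exists p => //; apply/S0_clopenP.
  move: Tp; rewrite (S0_Th (S0_modelP T)) (S0_Th (S0_modelP U)).
  by move/(styp_satisfies (leqnn (depth p)) E).
have [q hq] := definable_typ (fun t => t = stp k T).
have {}hq U : S0_clopen q U <-> stp k U = stp k T.
  rewrite S0_clopenP (S0_Th (S0_modelP U)); exact: hq.
rewrite nbhsE; exists (S0_clopen q); last by move=> U /hq /hk.
split; last exact/hq.
exists [set q] => //; exact: bigcup_set1.
Qed.

Lemma oplus_continuous : continuous (fun x : S0 * S0 => oplus x.1 x.2).
Proof.
move=> [T U] A /S0_nbhsP[k hk].
exists ([set V | stp k V = stp k T], [set V | stp k V = stp k U]).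
  by split; apply/S0_nbhsP; exists k.
by move=> [V W] [/= hV hW]; apply: hk; exact: stp_oplus_eq.
Qed.

(** * The space of theories as an inverse limit *)

Section Stage.
Variable k : nat.

(** A boolean predicate, so that [mso_type] inherits finiteness. By [fin_pseudofinite], the types of
    all models are among these. *)
Definition realized (t : tp k 0) := `[< exists n, t = styp k (mso n) >].
Definition mso_type := {t : tp k 0 | realized t}.

Definition mso_type_of (t : tp k 0) (h : exists n, t = styp k (mso n)) : mso_type :=
  exist (fun t => is_true (realized t)) t (asboolT h).

Definition type_class (n : nat) : mso_type := mso_type_of (ex_intro _ n erefl).

Lemma type_classP m n :
  type_class m = type_class n <-> styp k (mso m) = styp k (mso n).
Proof. by split=> [/(congr1 val)|h]; [|exact: val_inj]. Qed.

Lemma type_class_surj (x : mso_type) : exists n, type_class n = x.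
Proof.
have /asboolP[n hn] := valP x; exists n; apply: val_inj; exact/esym.
Qed.

Definition type_size (x : mso_type) : nat := sval (cid (type_class_surj x)).

Lemma type_sizeK : cancel type_size type_class.
Proof. by move=> x; rewrite /type_size; case: cid. Qed.

(** Computed on representatives; [type_classD] shows independence of the choice. *)
Definition type_mul (x y : mso_type) := type_class (type_size x + type_size y).

Lemma type_classD m n : type_mul (type_class m) (type_class n) = type_class (m + n).
Proof.
apply/type_classP; rewrite -!styp_osum_mso.
by apply: osum_styp; try exact: mso_atomic_order; apply/type_classP; rewrite type_sizeK.
Qed.

Lemma type_mulA : associative type_mul.
Proof.
move=> x y z; rewrite -[x]type_sizeK -[y]type_sizeK -[z]type_sizeK.
by rewrite !type_classD addnA.
Qed.

Lemma type_mul1 : left_id (type_class 0) type_mul.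
Proof. by move=> x; rewrite -[x]type_sizeK type_classD. Qed.

Lemma type_1mul : right_id (type_class 0) type_mul.
Proof. by move=> x; rewrite -[x]type_sizeK type_classD addn0. Qed.

HB.instance Definition _ := Finite.on mso_type.
HB.instance Definition _ := isMonoid.Build mso_type type_mulA type_mul1 type_1mul.

End Stage.

Definition type_trans j k (h : j <= k) (x : mso_type k) : mso_type j :=
  type_class j (type_size x).

Lemma type_transE j k (h : j <= k) n :
  type_trans h (type_class k n) = type_class j n.
Proof.
by apply/type_classP/(typ_leq h)/type_classP; rewrite type_sizeK.
Qed.

Lemma type_trans_morphism j k (h : j <= k) : monoid_morphism (type_trans h).
Proof.
split=> [|x y]; first exact: type_transE.
rewrite -[x]type_sizeK -[y]type_sizeK.
by rewrite [(_ * _)%g]type_classD !type_transE [RHS]type_classD.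
Qed.

Lemma type_trans_id k (h : k <= k) : type_trans h =1 id.
Proof. by move=> x; rewrite -[x]type_sizeK type_transE. Qed.

Lemma type_trans_comp i j k (hij : i <= j) (hjk : j <= k) (hik : i <= k) :
  type_trans hij \o type_trans hjk =1 type_trans hik.
Proof. by move=> x; rewrite /= -[x]type_sizeK !type_transE. Qed.

Lemma leq_directed (i j : nat) : exists k, i <= k /\ j <= k.
Proof. by exists (maxn i j); rewrite leq_maxl leq_maxr. Qed.

Definition type_system : inverse_system := @InverseSystem nat (fun j k => j <= k)
  leqnn (fun i j k hij hjk => leq_trans hij hjk) (inhabits 0) leq_directed
  (fun k => mso_type k : finMonoidType) type_trans type_trans_morphism
  type_trans_id type_trans_comp.

Definition S0_top : topologicalMonoidType :=
  S0_topmonoid oplusA oplus0l oplus0r oplus_continuous.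

(** The topology of the limit is initial for its coordinates, which take values in discrete
    spaces. *)
Lemma invlim_continuous (X : topologicalType) (D : inverse_system)
    (f : X -> invlim D) :
  (forall i x, nbhs x [set y | coord (f y) i = coord (f x) i]) -> continuous f.
Proof.
move=> hf; apply: continuous_comp_initial => x.
apply/cvg_sup.
move=> i; move: x; apply/(@continuousP _ (initial_topology (@^~ i))).
move=> A [B _ <-]; rewrite openE => x Bx.
apply: filterS (hf i x) => y /= hy; move: Bx; rewrite /preimage /=.
by rewrite -[set_val (f x) i]/(coord (f x) i) -hy.
Qed.

Lemma nbhs_coord (X : topologicalType) (D : inverse_system) (f : X -> invlim D)
    (i : idx D) (x : X) :
  continuous f -> nbhs x [set y | coord (f y) i = coord (f x) i].
Proof.
move=> hf; apply: (hf x [set z | coord z i = coord (f x) i]).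
exact: (@coord_continuous D i (f x) _
  (discrete_set1 (coord (f x) i : discrete_topology _))).
Qed.

Definition stp_class k (T : S0) : mso_type k := mso_type_of (stp_mso k T).

Lemma stp_classE k (T : S0) n :
  stp_class k T = type_class k n <-> stp k T = styp k (mso n).
Proof. by split=> [/(congr1 val)|h]; [|exact: val_inj]. Qed.

Lemma stp_class_eq k (T U : S0) : stp_class k T = stp_class k U <-> stp k T = stp k U.
Proof. by split=> [/(congr1 val)|h]; [|exact: val_inj]. Qed.

Lemma stp_class_trans j k (h : j <= k) (T : S0) :
  type_trans h (stp_class k T) = stp_class j T.
Proof.
have [n hn] := stp_mso k T; have /stp_classE -> := hn; rewrite type_transE.
exact/esym/stp_classE/(typ_leq h).
Qed.

Definition S0_thread (T : S0) : invlim type_system :=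
  @mk_invlim type_system (fun k => stp_class k T) (fun j k h => stp_class_trans h T).

(** A thread is a coherent sequence of types of finite orders, so compactness realizes it. The
    resulting structure is a model because at the depth of each axiom it looks like a finite
    order. *)
Lemma S0_thread_surj (x : invlim type_system) : exists T, S0_thread T = x.
Proof.
pose n k := type_size (coord x k : mso_type k).
have [|M hM] := @mso_compactness n.
  move=> j k jk; apply/type_classP; rewrite !type_sizeK.
  by rewrite -(@coordP type_system x j k jk).
have hF : fin_struct M.
  apply/T_MSOFinP => p Tp.
  apply/(styp_satisfies (leqnn _) (hM (depth p))).
  by move: (mso_fin (n (depth p))) => /T_MSOFinP; exact.
exists (S0_of hF); apply: coord_inj => k; rewrite coord_mk -[RHS]type_sizeK.
by apply/stp_classE; rewrite -hM; apply: stp_models => p.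
Qed.

Lemma S0_thread_inj : injective S0_thread.
Proof.
move=> T U E; apply: S0_ext => k; apply/stp_class_eq.
exact: (congr1 (fun x : invlim type_system => coord x k) E).
Qed.

Lemma S0_profinite : profinite S0_top.
Proof.
exists type_system.
have /choice[g gK] := S0_thread_surj.
exists S0_thread, g; split.
- by move=> T; apply: S0_thread_inj; rewrite gK.
- exact: gK.
- split=> [|T U]; apply: (@coord_inj type_system) => k.
    by apply/stp_classE; exact: stp_S0_mso.
  have [m /[dup] hm /stp_classE hm'] := stp_mso k T.
  have [n /[dup] hn /stp_classE hn'] := stp_mso k U.
  rewrite -[LHS]/(stp_class k (oplus T U)).
  rewrite -[RHS]/(type_mul (stp_class k T) (stp_class k U)) hm' hn' type_classD.
  by apply/stp_classE; exact: stp_oplus_mso.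
- apply: invlim_continuous => k T; apply/S0_nbhsP; exists k => U E.
  exact/stp_class_eq.
(* The type of [g y] at depth [k] is coordinate [k] of [y], which is locally constant. *)
move=> x A /S0_nbhsP[k hk].
apply: filterS (@nbhs_coord _ type_system id k x _) => [y /= hy|]; last by move=> ?.
apply: hk; apply/stp_class_eq.
by rewrite -[LHS]/(coord (S0_thread (g y)) k) -[RHS]/(coord (S0_thread (g x)) k) !gK.
Qed.

(** * The universal property *)

Lemma monoid_morphismX (P Q : monoidType) (f : P -> Q) (x : P) n :
  monoid_morphism f -> f (x ^+ n)%g = (f x ^+ n)%g.
Proof.
by move=> [f1 fM]; elim: n => [|n IHn]; rewrite ?expg0 // !expgS fM IHn.
Qed.

Lemma S0_mso_image (P : monoidType) (h : S0_top -> P) n :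
  monoid_morphism h -> h (S0_mso n) = (h (S0_mso 1) ^+ n)%g.
Proof.
move=> [h1 hM]; elim: n => [|n IHn]; first exact: h1.
rewrite expgS -IHn -hM -(S0_msoD 1 n); exact.
Qed.

Definition stp_size k (T : S0) : nat := sval (cid (stp_mso k T)).

Lemma stp_sizeP k (T : S0) : stp k T = styp k (mso (stp_size k T)).
Proof. exact: svalP (cid (stp_mso k T)). Qed.

Section ExtendToInverseLimit.
Variables (D : inverse_system) (p : invlim D).

Definition exp_rank (i : idx D) : nat := sval (cid (styp_expg (coord p i))).

(** The power of [p] with exponent [T]: at stage [i], a finite order of the same type at depth
    [exp_rank i] replaces [T]. *)
Definition extend_coord (T : S0) (i : idx D) : stage i :=
  (coord p i ^+ stp_size (exp_rank i) T)%g.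

(** Any depth beyond [exp_rank i] gives an admissible exponent, so two stages can share one
    exponent. *)
Lemma extend_coordE T i k n : exp_rank i <= k -> stp k T = styp k (mso n) ->
  extend_coord T i = (coord p i ^+ n)%g.
Proof.
move=> ik hn; apply: (svalP (cid (styp_expg (coord p i)))).
rewrite -stp_sizeP; exact: typ_leq ik hn.
Qed.

Lemma extend_coord_trans T i j (h : idx_le i j) :
  transition h (extend_coord T j) = extend_coord T i.
Proof.
pose k := maxn (exp_rank i) (exp_rank j); have hn := stp_sizeP k T.
rewrite (extend_coordE (leq_maxl _ _) hn) (extend_coordE (leq_maxr _ _) hn).
by rewrite monoid_morphismX ?coordP //; exact: transition_morphism.
Qed.

Definition extend (T : S0) : invlim D := mk_invlim (@extend_coord_trans T).

Lemma extend_morphism : monoid_morphism (extend : S0_top -> invlim D).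
Proof.
split=> [|T U]; apply: coord_inj => i.
  exact: (extend_coordE (leqnn _) (stp_S0_mso _ 0)).
rewrite -[LHS]/(extend_coord (oplus T U) i).
rewrite -[RHS]/(extend_coord T i * extend_coord U i)%g -expgnDr.
by apply: (extend_coordE (leqnn _)); apply: stp_oplus_mso; exact: stp_sizeP.
Qed.

Lemma extend_continuous : continuous (extend : S0_top -> invlim D).
Proof.
apply: invlim_continuous => i T; apply/S0_nbhsP; exists (exp_rank i) => U E.
by apply: (extend_coordE (leqnn _)); rewrite E; exact: stp_sizeP.
Qed.

Lemma extend_generator : extend (S0_mso 1) = p.
Proof.
apply: coord_inj => i; exact: (extend_coordE (leqnn _) (stp_S0_mso _ 1)).
Qed.

End ExtendToInverseLimit.

(** Density: near [T] there is some [S0_mso n] where both maps have the same coordinate [i] as at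
    [T], and there both are powers of the image of the generator. *)
Lemma S0_morphism_unique (D : inverse_system) (f g : S0_top -> invlim D) :
  continuous f -> monoid_morphism f -> continuous g -> monoid_morphism g ->
  f (S0_mso 1) = g (S0_mso 1) -> f = g.
Proof.
move=> fC fM gC gM E; apply/funext => T; apply: coord_inj => i.
have /S0_nbhsP[k hk] := nbhs_coord i T fC.
have /S0_nbhsP[l hl] := nbhs_coord i T gC.
pose n := stp_size (maxn k l) T; have hn : stp (maxn k l) (S0_mso n) = stp (maxn k l) T.
  by rewrite stp_S0_mso -stp_sizeP.
rewrite -(hk _ (typ_leq (leq_maxl k l) hn)) -(hl _ (typ_leq (leq_maxr k l) hn)).
by rewrite S0_mso_image // E -S0_mso_image.
Qed.

Lemma S0_free : @free_profinite_monoid1 S0_top (S0_mso 1).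
Proof.
split; first exact: S0_profinite.
move=> P [D [u [v [uK vK uM uC vC]]]] p.
have vM : monoid_morphism v.
  split=> [|x y]; apply: (can_inj uK); rewrite ?uM ?vK //.
(* [P] is traded for an inverse limit isomorphic to it, where powers of [u p] are available. *)
exists (v \o extend (u p)); split; first split.
- by move=> T; apply: continuous_comp; [exact: extend_continuous|exact: vC].
- split=> [|T U] /=; first by rewrite (extend_morphism (u p)) vM.
  by rewrite (extend_morphism (u p)).2 vM.
- by rewrite /= extend_generator uK.
move=> h [hC hM hp]; apply/funext => T; apply: (can_inj uK); rewrite /= vK.
have := @S0_morphism_unique D (extend (u p)) (u \o h).
move=> /(_ (@extend_continuous _ _) (@extend_morphism _ _)) -> //.
- by move=> U; apply: continuous_comp; [exact: hC|exact: uC].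
- by split=> [|x y] /=; rewrite hM uM.
by rewrite extend_generator /= hp.
Qed.

Theorem theorem5p14 :
  exists op : S0 -> S0 -> S0, is_oplus op /\
  exists (e : S0) (opA : associative op)
         (op1 : left_id e op) (op1r : right_id e op)
         (op_continuous : continuous (fun x : S0 * S0 => op x.1 x.2)),
  exists (F : topologicalMonoidType) (g : F), free_profinite_monoid1 g /\
    topmonoid_isomorphic (S0_topmonoid opA op1 op1r op_continuous) F.
Proof.
exists oplus; split; first exact: oplusP.
exists (S0_mso 0), oplusA, oplus0l, oplus0r, oplus_continuous, S0_top, (S0_mso 1).
split; first exact: S0_free.
(* The space of theories is itself free, on the theory of the one-point order. *)
by exists id, id; split=> // x A.
Qed.
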